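(* Let $L$ be a triangulation of the $k$-dimensional simplex such that the only vertices of $L$ on the boundary of the simplex are the original vertices of the simplex, and such that $L$ has at least one vertex in the interior. Let $j\in\{2,\ldots,k+1\}$. For all $n\geq k+1$, the generalized Tchebyshev polynomials of the $j$th kind $U^{L,j}_n(x)$ satisfy a recurrence of the form $$U^{L,j}_n(x)=\sum_{\ell=1}^{k+1}p^L_\ell(x)\,U^{L,j}_{n-\ell}(x),$$ where each $p^L_\ell(x)$ is a polynomial of $x$ and equals the coefficient of $t^\ell$ in $$(-2t)^{k+1}\,r_L\!\left(-\frac{1+t}{2t},-\frac{1+x}{2}\right).$$
   Context: Simplicial complexes are finite abstract simplicial complexes, containing the empty face; $k\geq 1$. The link of a face $\sigma$ of $K$ is $\mathrm{link}_K(\sigma)=\{\tau\in K: \sigma\cap\tau=\emptyset,\ \sigma\cup\tau\in K\}$. $f_i(K)$ is the number of $i$-dimensional faces of $K$. The $F$-polynomial of $K$ is $F(K,x)=\sum_{j=0}^{\dim K+1} f_{j-1}(K)\left(\frac{x-1}{2}\right)^j$. $\partial(L)$ denotes the subcomplex of boundary faces of $L$, which is the boundary complex of the original $k$-simplex; $V(\partial(L))$ is its vertex set (the original vertices) and $V(\mathrm{Int}(L))$ is the set of vertices of $L$ lying in the interior. The magic polynomial of $L$ is $$r_L(u,v)=\sum_{\sigma\in L\setminus\partial(L)} u^{|\sigma\cap V(\partial(L))|}v^{|\sigma\cap V(\mathrm{Int}(L))|}-u^{k+1}.$$ A simplicial complex $K'$ is a generalized Tchebyshev triangulation of $K$ induced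 by $L$ if there is an ordered list $\sigma_1,\ldots,\sigma_m$ of the $k$-dimensional faces of $K$, listing each exactly once, bijections $\phi_{\sigma_i}:V(\partial(L))\to\sigma_i$, and simplicial complexes $K_0=K,K_1,\ldots,K_m=K'$ such that for each $i\geq 1$ the complex $K_i$ is obtained from $K_{i-1}$ as follows: take an isomorphic copy $L_i$ of $L$ in which each boundary vertex $w\in V(\partial(L))$ is identified with $\phi_{\sigma_i}(w)$ and the interior vertices are new vertices, and replace the family of faces $\{\sigma_i\cup\tau:\tau\in\mathrm{link}_{K_{i-1}}(\sigma_i)\}$ by the family $\{\sigma'\cup\tau:\sigma'\in L_i,\ \tau\in\mathrm{link}_{K_{i-1}}(\sigma_i)\}$. For $j\in\{2,\ldots,k+1\}$ there is a unique linear map $U^{L,j}:\mathbb{R}[x]\to\mathbb{R}[x]$ satisfying $U^{L,j}(x^n)=0$ for $n\leq j-2$ and such that for every simplicial complex $K$ and every generalized Tchebyshev triangulation $K'$ of $K$ induced by $L$, $$U^{L,j}(F(K,x))=\sum_{\sigma\in K,\ |\sigma|=j-1}F(\mathrm{link}_{K'}(\sigma),x).$$ The generalized Tchebyshev polynomial of the $j$th kind is $U^{L,j}_n(x)=2^{1-j}\,(j-1)!\,U^{L,j}(x^{n+j-1})$. *)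

(* Defs.v *)
From HB Require Import structures.
From mathcomp Require Import all_boot all_order all_algebra.
From mathcomp Require Import finmap.
From mathcomp Require Import boolp classical_sets reals.

Set Implicit Arguments.
Unset Strict Implicit.
Unset Printing Implicit Defensive.

Import Order.TTheory GRing.Theory Num.Theory.

Local Open Scope fset_scope.
Local Open Scope ring_scope.

Section Complexes.
Context {V : choiceType}.
Implicit Types (K : {fset {fset V}}) (s : {fset V}).

Definition is_complex K : Prop :=
  fset0 \in K /\ forall s t : {fset V}, s \in K -> t `<=` s -> t \in K.

Definition vertices K : {fset V} := fcover K.

Definition link K s : {fset {fset V}} :=
  [fset t in K | [disjoint s & t]%fset && (s `|` t \in K)].

Definition face_number K (j : nat) : nat := #|` [fset s in K | #|` s| == j] |.

(* dim K + 1 *)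
Definition max_face_card K : nat := (\max_(s <- K) #|` s|)%N.

(* [face_number K j] is f_{j-1}(K). *)
Definition Fpoly (R : realType) K : {poly R} :=
  \sum_(j < (max_face_card K).+1)
    (face_number K j)%:R *: (2^-1 *: ('X - 1)) ^+ j.

End Complexes.

(* The k-dimensional simplex is the standard one in R^{k+1}; its original
   vertices are the unit vectors [delta_mx 0 i]. *)
Section Geometry.
Context {R : realType} {k : nat}.

Definition std_simplex : set 'rV[R]_k.+1 :=
  [set x | (forall i, 0 <= x 0 i) /\ \sum_i x 0 i = 1]%classic.

Definition simplex_interior : set 'rV[R]_k.+1 :=
  [set x | std_simplex x /\ forall i, 0 < x 0 i]%classic.

Definition simplex_boundary : set 'rV[R]_k.+1 :=
  (std_simplex `\` simplex_interior)%classic.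

Definition conv_hull {W : choiceType} (pos : W -> 'rV[R]_k.+1) (s : {fset W}) :
    set 'rV[R]_k.+1 :=
  [set x | exists c : W -> R, [/\ forall w, w \in s -> 0 <= c w,
     \sum_(w <- s) c w = 1 & x = \sum_(w <- s) c w *: pos w]]%classic.

Definition affinely_independent {W : choiceType} (pos : W -> 'rV[R]_k.+1)
    (s : {fset W}) : Prop :=
  forall c : W -> R, \sum_(w <- s) c w = 0 -> \sum_(w <- s) c w *: pos w = 0 ->
    forall w, w \in s -> c w = 0.

(* The complex [L], with each vertex [w] placed at the point [pos w], is a
   geometric simplicial complex whose underlying space is the simplex. *)
Record simplex_triangulation {W : choiceType} (L : {fset {fset W}})
    (pos : W -> 'rV[R]_k.+1) : Prop := SimplexTriangulation {
  triang_complex : is_complex L;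
  triang_indep : forall s, s \in L -> affinely_independent pos s;
  triang_inter : forall s t, s \in L -> t \in L ->
    (conv_hull pos s `&` conv_hull pos t)%classic = conv_hull pos (s `&` t);
  triang_cover : (\bigcup_(s in [set` L]) conv_hull pos s)%classic = std_simplex
}.

Context {W : choiceType} (L : {fset {fset W}}) (pos : W -> 'rV[R]_k.+1).

Definition no_new_boundary_vertices : Prop :=
  forall w, w \in vertices L -> simplex_boundary (pos w) ->
    exists i, pos w = delta_mx 0 i.

Definition boundary_complex : {fset {fset W}} :=
  [fset s in L | `[< (conv_hull pos s `<=` simplex_boundary)%classic >]].

Definition boundary_vertices : {fset W} := vertices boundary_complex.

Definition interior_vertices : {fset W} :=
  [fset w in vertices L | `[< simplex_interior (pos w) >]].

(* r_L(u,v), with u the outer variable 'X and v the inner variable 'Y *)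
Definition magic_poly : {poly {poly R}} :=
  \sum_(s <- (L `\` boundary_complex)%fset)
     'X ^+ #|` s `&` boundary_vertices| * 'Y ^+ #|` s `&` interior_vertices|
  - 'X ^+ k.+1.

(* The map [iota] restricts to the bijection phi_s from the boundary vertices
   onto [s], and sends the interior vertices to new vertices, so that the faces
   [iota @` s'] form the isomorphic copy of [L]. *)
Definition tchebyshev_step {V : choiceType} (s : {fset V})
    (K K' : {fset {fset V}}) : Prop :=
  exists iota : W -> V,
    [/\ {in vertices L &, injective iota},
        iota @` boundary_vertices = s,
        forall w, w \in interior_vertices -> iota w \notin vertices K
      & K' = (K `\` [fset s `|` (t : {fset V}) | t in link K s])
             `|` [fset (iota @` (s' : {fset W})) `|` (t : {fset V})
                 | s' in L, t in link K s]].

Definition tchebyshev_triangulation {V : choiceType} (K K' : {fset {fset V}}) :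
    Prop :=
  exists (ss : seq {fset V}) (Ks : nat -> {fset {fset V}}),
    [/\ uniq ss,
        forall s, (s \in ss) = (s \in K) && (#|` s| == k.+1),
        Ks 0%N = K /\ Ks (size ss) = K',
        forall i, (i <= size ss)%N -> is_complex (Ks i)
      & forall i, (i < size ss)%N ->
          tchebyshev_step (nth fset0 ss i) (Ks i) (Ks i.+1)].

Definition is_tchebyshev_map (j : nat) (U : {linear {poly R} -> {poly R}}) :
    Prop :=
  (forall n, (n <= j - 2)%N -> U 'X^n = 0) /\
  (forall (V : choiceType) (K K' : {fset {fset V}}),
     is_complex K -> tchebyshev_triangulation K K' ->
     U (Fpoly R K) = \sum_(s <- K | #|` s| == (j - 1)%N) Fpoly R (link K' s)).

End Geometry.

Definition tchebyshev_poly {R : realType} (U : {linear {poly R} -> {poly R}})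
    (j n : nat) : {poly R} :=
  ((j - 1)`!%:R / 2 ^+ (j - 1)) *: U 'X^(n + (j - 1)).

(* Evaluation of r(u,v) at elements of the field R(x)(t), which is represented
   by the fractions of {poly {poly R}} with t the outer and x the inner
   variable. *)
Definition eval_frac {R : realType} (r : {poly {poly R}})
    (u v : {fraction {poly {poly R}}}) : {fraction {poly {poly R}}} :=
  (map_poly (map_poly (fun a : R => tofrac (a%:P%:P : {poly {poly R}}))) r).[u, v].

(* Main.v *)
Require Import Defs.
From mathcomp Require Import all_boot all_order all_algebra.
From mathcomp Require Import finmap.
From mathcomp Require Import boolp classical_sets reals.
From mathcomp Require Import ring lra zify.

(** Give every original vertex the weight u and every new vertex the weight v,
    and let the weight of a face be the product of the weights of its vertices.
    A subdivision step replaces the star of a face s by the join of L with the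
    link of s; on weight sums it adds r_L(u,v) times the weight sum of the link
    ([weight_sum_subdivide]).  Once all k-faces have been treated, every face
    keeps at most k original vertices.  Hence, with v = z = (x - 1) / 2, the
    weight sum of K' is a polynomial in u of degree at most k congruent to that
    of K modulo r_L(u, z); since r_L(u, z) has leading term - u^(k+1), it is the
    remainder of the weight sum of K.

    The F-polynomials of the links of the (j-1)-subsets of the original vertices
    add up to the (j-1)-st divided derivative in u of the weight sum of K', at
    u = z ([sum_links_nderivn]).  A full simplex with d vertices has weight sum
    (u + 1)^d and F-polynomial ((x + 1) / 2)^d; these polynomials span, so
    U(x^m) is the value of [reduced_eval] at (2 u + 1)^m
    ([tchebyshev_map_simplex], [tchebyshev_map_Xn]).  As [reduced_eval] is
    linear over R[x] and kills the multiples of r_L(u, z), expanding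
    2^(k+1) r_L(u, z) in powers of 2 u + 1 yields a recurrence of order k + 1.

    This recurrence has the stated coefficients thanks to the reciprocity
    r_L(-1-u, -1-v) = (-1)^(k+1) r_L(u, v) ([magic_reciprocity]), a form of the
    Dehn-Sommerville relations.  For its proof, regard the triangulation as a fan
    of simplicial cones filling the nonnegative orthant, and choose a generic
    direction q in the open orthant.  Starting from the sum of the vertices of a
    face s, a small step along q enters the interior of exactly one full cone T,
    and the vertices of T with negative coefficient in q all belong to s; so the
    faces of L are partitioned into the intervals [T^-, T].  A small step along
    - q shows that the interior faces are partitioned into the intervals
    [T^+, T] ([weight_sum_facets], [weight_sum_interior_facets]).  The
    substitution w |-> -1 - w exchanges the two products attached to T. *)

Set Implicit Arguments.
Unset Strict Implicit.
Unset Printing Implicit Defensive.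

Import Order.TTheory GRing.Theory Num.Theory.
Local Open Scope fset_scope.
Local Open Scope ring_scope.

(** * Weighted face counts *)

Lemma big_fsetU_disjoint (R : Type) (idx : R) (op : Monoid.com_law idx)
    (I : choiceType) (A B : {fset I}) (F : I -> R) : [disjoint A & B]%fset ->
  \big[op/idx]_(i <- A `|` B) F i =
  op (\big[op/idx]_(i <- A) F i) (\big[op/idx]_(i <- B) F i).
Proof.
move=> /fdisjointP AB; rewrite (big_fsetID _ (mem A)) /=.
congr (op _ _); apply: eq_fbigl => i; rewrite !inE /=.
  by case: (i \in A); rewrite ?andbF.
by case iA: (i \in A); rewrite ?andbT //= (negPf (AB _ iA)).
Qed.

Section Weights.
Context {V : choiceType} {A : comNzRingType}.
Implicit Types (g h : V -> A) (s t : {fset V}) (K : {fset {fset V}}).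

Definition face_weight g s : A := \prod_(w <- s) g w.

Definition weight_sum g K : A := \sum_(s <- K) face_weight g s.

Lemma face_weightU g s t : [disjoint s & t]%fset ->
  face_weight g (s `|` t) = face_weight g s * face_weight g t.
Proof. exact: big_fsetU_disjoint. Qed.

Lemma face_weight_const g s (a : A) :
  {in s, forall w, g w = a} -> face_weight g s = a ^+ #|` s|.
Proof.
move=> ga; rewrite /face_weight (eq_fbigr _ (G := fun=> a)) => [|w ws _]; last exact: ga.
by rewrite big_const_seq count_predT iter_mulr_1.
Qed.

Lemma face_weight_mem (a b : A) (B s : {fset V}) :
  face_weight (fun w => if w \in B then a else b) s =
  a ^+ #|` s `&` B| * b ^+ #|` s `\` B|.
Proof.
rewrite -{1}(fsetID B s) face_weightU; last first.
  by apply/fdisjointP => w; rewrite !inE => /andP[_ ->].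
congr (_ * _); apply: face_weight_const => w; rewrite !inE.
  by move=> /andP[_ ->].
by move=> /andP[/negPf->].
Qed.

Lemma fpowersetU1 x s :
  fpowerset (x |` s) = fpowerset s `|` [fset x |` t | t in fpowerset s].
Proof.
apply/fsetP => t; rewrite in_fsetU !fpowersetE; apply/idP/orP => [ts|[ts|]].
- case xt: (x \in t); [right|left]; last first.
    apply/fsubsetP => w wt; move/fsubsetP: ts => /(_ _ wt).
    by rewrite !inE => /orP[/eqP wx|//]; rewrite -wx wt in xt.
  apply/imfsetP; exists (t `\ x) => /=; last by rewrite fsetD1K.
  by rewrite fpowersetE; apply/fsubsetP => w; rewrite !inE => /andP[wx wt];
     move/fsubsetP: ts => /(_ _ wt); rewrite !inE (negPf wx).
- exact: fsubset_trans ts (fsubsetU1 _ _).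
- case/imfsetP => t' /=; rewrite fpowersetE => t's ->.
  by rewrite fsetUS.
Qed.

(** Every element of s chooses one of the two summands, and t collects those that
    choose g. *)
Lemma prodD_expand g h s :
  \prod_(w <- s) (g w + h w) =
  \sum_(t <- fpowerset s) face_weight g t * face_weight h (s `\` t).
Proof.
elim/finSet_rect: s => s IH.
have [->|[x xs]] := fset_0Vmem s.
  by rewrite big_seq_fset0 fpowerset0 big_seq_fset1 fset0D /face_weight !big_seq_fset0 mulr1.
rewrite (big_fsetD1 x) //= IH ?fproperD1 //.
set s' := s `\ x; have xs' : x \notin s' by rewrite !inE eqxx.
rewrite -(fsetD1K xs) -/s' fpowersetU1 mulrDl.
clearbody s'.
rewrite [RHS](big_fsetID _ (fun t : {fset V} => x \in t)) /=; congr (_ + _).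
  rewrite mulr_sumr.
  rewrite [RHS](eq_fbigl _ (B := [fset x |` t | t in fpowerset s'])); last first.
    move=> t; rewrite !inE /=; apply/andP/idP => [[/orP[|//] ts' xt]|].
      by move: xs'; rewrite fpowersetE in ts'; rewrite (fsubsetP ts').
    by move=> tt; rewrite tt orbT; split=> //; case/imfsetP: tt => /= ? _ ->; rewrite !inE eqxx.
  have addK : {in fpowerset s' &, injective (fun t => x |` t)}.
    move=> t1 t2; rewrite !fpowersetE => ts1 ts2 /(congr1 (fun y => y `\ x)).
    by rewrite !fsetU1K //; apply: contra xs'; apply: fsubsetP.
  rewrite [RHS]big_imfset //=.
  apply: eq_fbigr => t; rewrite fpowersetE => ts' _.
  have xt : x \notin t by apply: contra xs'; apply: fsubsetP.
  rewrite [face_weight g (_ |` _)]/face_weight big_fsetU1 //= mulrA; congr (_ * face_weight _ _).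
  apply/fsetP => w; rewrite !inE; case: (w =P x) => //= ->.
  by rewrite (negPf xs') ?andbF.
rewrite mulr_sumr.
rewrite [RHS](eq_fbigl _ (B := fpowerset s')); last first.
  move=> t; rewrite !inE /=; apply/andP/idP => [[/orP[//|]]|ts'].
    by case/imfsetP => /= ? _ ->; rewrite !inE eqxx.
  split; first by rewrite ts'.
  by apply: contra xs'; apply: fsubsetP; rewrite -fpowersetE.
apply: eq_fbigr => t; rewrite fpowersetE => ts' _.
have xt : x \notin t by apply: contra xs'; apply: fsubsetP.
rewrite mulrCA; congr (_ * _).
rewrite [RHS]/face_weight (_ : (x |` s') `\` t = x |` (s' `\` t)); last first.
  by apply/fsetP => w; rewrite !inE; case: (w =P x) => //= ->; rewrite xt.
by rewrite big_fsetU1 // inE (negPf xs') andbF.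
Qed.

Lemma weight_sum_fpowerset g s :
  weight_sum g (fpowerset s) = \prod_(w <- s) (g w + 1).
Proof.
rewrite (prodD_expand g (fun=> 1)); apply: eq_bigr => t _.
by rewrite [face_weight (fun=> 1) _]/face_weight big1_eq mulr1.
Qed.

(** In the expansion of the product of g w + [w \notin N] exactly the t above N
    survive. *)
Lemma weight_sum_interval g (N T : {fset V}) : N `<=` T ->
  \sum_(t <- fpowerset T | N `<=` t) face_weight g t =
  \prod_(w <- T) (if w \in N then g w else g w + 1).
Proof.
move=> NT; rewrite (eq_bigr (fun w => g w + (w \notin N)%:R)); last first.
  by move=> w _; case: ifP => _; rewrite ?addr0.
rewrite prodD_expand big_mkcond /=; apply: eq_fbigr => t.
rewrite fpowersetE => tT _; case: ifPn => [Nt|/fsubsetPn[x xN xt]].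
  rewrite [X in _ * X](face_weight_const (a := 1)) ?expr1n ?mulr1 // => w.
  rewrite !inE => /andP[wt _]; case wN: (w \in N) => //.
  by move: wt; rewrite (fsubsetP Nt).
rewrite [X in _ * X](_ : _ = 0) ?mulr0 // /face_weight (big_fsetD1 x) /=.
  by rewrite xN mul0r.
by rewrite !inE xt (fsubsetP NT).
Qed.

(** The generating function of a family of faces that is partitioned into
    intervals [N T, T] with T in F. *)
Lemma weight_sum_partition g K (F : {fset {fset V}}) (N : {fset V} -> {fset V}) :
  (forall T, T \in F -> N T `<=` T) ->
  (forall T s, T \in F -> N T `<=` s -> s `<=` T -> s \in K) ->
  (forall s, s \in K -> exists2 T, T \in F & (N T `<=` s) && (s `<=` T)) ->
  (forall s T T', s \in K -> T \in F -> T' \in F ->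
     (N T `<=` s) && (s `<=` T) -> (N T' `<=` s) && (s `<=` T') -> T = T') ->
  weight_sum g K =
  \sum_(T <- F) \prod_(w <- T) (if w \in N T then g w else g w + 1).
Proof.
move=> NT inK cov uni.
transitivity (\sum_(s <- K) \sum_(T <- F | (N T `<=` s) && (s `<=` T)) face_weight g s).
  apply: eq_fbigr => s sK _; have [T TF Ts] := cov _ sK.
  rewrite big_mkcond (big_fsetD1 T) //= Ts big1_fset ?addr0 // => T'.
  rewrite !inE => /andP[TT' T'F] _; case: ifP => // T's.
  by rewrite (uni _ _ _ sK T'F TF T's Ts) eqxx in TT'.
under eq_bigr do rewrite big_mkcond /=.
rewrite exchange_big /=; apply: eq_fbigr => T TF _.
rewrite -weight_sum_interval ?NT // -big_mkcond /=.
apply: eq_fbigl_cond => s; rewrite !inE /= fpowersetE.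
apply/andP/andP => [[_ /andP[-> ->]]//|[sT Ns]].
by rewrite Ns sT (inK T).
Qed.

End Weights.

(** * Geometric triangulations as fans; half-open decompositions *)

Lemma mem_vertices (V : choiceType) (K : {fset {fset V}}) (w : V) :
  is_complex K -> (w \in vertices K) = ([fset w] \in K).
Proof.
move=> [_ dK]; apply/bigfcupP/idP => [[s /andP[sK _] ws]|wK].
  by apply: dK sK _; rewrite fsub1set.
by exists [fset w]; rewrite ?wK // inE.
Qed.

Lemma sub_vertices (V : choiceType) (K : {fset {fset V}}) (s : {fset V}) :
  s \in K -> s `<=` vertices K.
Proof.
move=> sK; apply/fsubsetP => w ws; apply/bigfcupP; exists s => //.
by rewrite sK.
Qed.

Section Fan.
Context {R : realType} {k : nat} {W : choiceType}.
Context (L : {fset {fset W}}) (pos : W -> 'rV[R]_k.+1).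
Hypothesis hL : simplex_triangulation L pos.
Implicit Types (s t T : {fset W}) (c a b : W -> R) (w : W).

Let cL : is_complex L := triang_complex hL.

Definition lin_comb c s : 'rV[R]_k.+1 := \sum_(w <- s) c w *: pos w.

Lemma lin_combE c s i : lin_comb c s 0 i = \sum_(w <- s) c w * pos w 0 i.
Proof. by rewrite summxE; apply: eq_bigr => w _; rewrite mxE. Qed.

Lemma lin_comb0 c : lin_comb c fset0 = 0.
Proof. exact: big_seq_fset0. Qed.

Lemma eq_lin_comb c a s : {in s, c =1 a} -> lin_comb c s = lin_comb a s.
Proof. by move=> ca; apply: eq_fbigr => w ws _; rewrite ca. Qed.

Lemma lin_comb_linear (x y : R) a b s :
  lin_comb (fun w => x * a w + y * b w) s = x *: lin_comb a s + y *: lin_comb b s.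
Proof.
rewrite /lin_comb !scaler_sumr -big_split /=; apply: eq_bigr => w _.
by rewrite scalerDl !scalerA.
Qed.

Lemma lin_comb_sub c s t : s `<=` t -> lin_comb c s = lin_comb (fun w => (w \in s)%:R * c w) t.
Proof.
move=> st; rewrite /lin_comb -[RHS](big_fset_incl _ st) => [|w _ /negPf->]; last first.
  by rewrite mul0r scale0r.
by apply: eq_fbigr => w ws _; rewrite ws mul1r.
Qed.

Lemma pos_simplex w : w \in vertices L -> std_simplex (pos w).
Proof.
move=> wL; rewrite -(triang_cover hL); exists [fset w] => /=.
  by rewrite -mem_vertices.
exists (fun=> 1); rewrite !big_seq_fset1 scale1r; split=> // ? _; exact: ler01.
Qed.

Lemma pos_ge0 s w i : s \in L -> w \in s -> 0 <= pos w 0 i.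
Proof.
move=> sL ws; have [h _] : std_simplex (pos w); last exact: h.
by apply: pos_simplex; apply: (fsubsetP (sub_vertices sL)).
Qed.

Lemma lin_comb_coordsum c s : s \in L -> \sum_i lin_comb c s 0 i = \sum_(w <- s) c w.
Proof.
move=> sL; under eq_bigr do rewrite lin_combE.
rewrite exchange_big /=; apply: eq_fbigr => w ws _; rewrite -mulr_sumr.
have [_ ->] : std_simplex (pos w); last by rewrite mulr1.
by apply: pos_simplex; apply: (fsubsetP (sub_vertices sL)).
Qed.

(** All [pos w] lie in the hyperplane where the coordinates add up to 1, so a
    linear dependence is automatically an affine one.  From here on the simplices
    are replaced by the cones that they span, which treats the empty face (the
    zero cone) like the others. *)
Lemma lin_comb_indep c s : s \in L -> lin_comb c s = 0 -> {in s, forall w, c w = 0}.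
Proof.
move=> sL c0; apply: (triang_indep hL sL _ c0).
by rewrite -(lin_comb_coordsum c sL) c0 big1 // => i _; rewrite mxE.
Qed.

Lemma lin_comb_inj a b s : s \in L -> lin_comb a s = lin_comb b s -> {in s, a =1 b}.
Proof.
move=> sL ab w ws; apply/eqP; rewrite -subr_eq0; apply/eqP.
have := @lin_comb_indep (fun w => 1 * a w + (-1) * b w) s sL; rewrite lin_comb_linear ab.
by rewrite scale1r scaleN1r subrr => /(_ erefl w ws); rewrite mul1r mulN1r.
Qed.

Lemma sum_ge0_eq0 c s : {in s, forall w, 0 <= c w} -> \sum_(w <- s) c w = 0 ->
  {in s, forall w, c w = 0}.
Proof.
move=> c0 /eqP; rewrite big_seq_fsetE /= psumr_eq0 => [|i _]; last exact/c0/valP.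
by move=> /allP h w ws; have := h [` ws] (mem_index_enum _) => /eqP.
Qed.

(** Scaling a common point of the two cones into the simplices turns the
    intersection property of the triangulation into one for cones: a vector has the
    same support in all cones that contain it. *)
Lemma cone_inter s t a b w : s \in L -> t \in L ->
  {in s, forall w, 0 <= a w} -> {in t, forall w, 0 <= b w} ->
  lin_comb a s = lin_comb b t -> w \in s -> 0 < a w -> w \in t.
Proof.
move=> sL tL a0 b0 ab ws aw.
set m := \sum_(w <- s) a w.
have m0 : 0 < m.
  rewrite lt_neqAle eq_sym /m big_seq sumr_ge0 ?andbT //; apply/negP => /eqP.
  by rewrite -big_seq => /(sum_ge0_eq0 a0) /(_ w ws) a0'; rewrite a0' ltxx in aw.
have mb : m = \sum_(w <- t) b w by rewrite /m -(lin_comb_coordsum a sL) ab lin_comb_coordsum.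
have : (conv_hull pos s `&` conv_hull pos t)%classic (m^-1 *: lin_comb a s).
  split; [exists (fun w => m^-1 * a w)|exists (fun w => m^-1 * b w)].
    split=> [w' /a0 aw'||].
    - by rewrite mulr_ge0 // invr_ge0 ltW.
    - by rewrite -mulr_sumr mulVf // gt_eqF.
    - by rewrite scaler_sumr; apply: eq_bigr => w' _; rewrite scalerA.
  split=> [w' /b0 bw'||].
  - by rewrite mulr_ge0 // invr_ge0 ltW.
  - by rewrite -mulr_sumr -mb mulVf // gt_eqF.
  - by rewrite ab scaler_sumr; apply: eq_bigr => w' _; rewrite scalerA.
rewrite (triang_inter hL sL tL) => -[d [d0 _ dE]].
have {}dE : lin_comb (fun w => m^-1 * a w + 0 * 0) s =
   lin_comb (fun w => (w \in s `&` t)%:R * d w) s.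
  rewrite -lin_comb_sub ?fsubsetIl //; move: dE; rewrite -/(lin_comb _ _) => <-.
  by rewrite lin_comb_linear scale0r addr0.
have := lin_comb_inj sL dE ws; rewrite mul0r addr0 inE ws /=.
case: (w \in t) => //; rewrite mul0r => /eqP; rewrite mulf_eq0 invr_eq0.
by rewrite !gt_eqF.
Qed.

Lemma cone_cover (x : 'rV[R]_k.+1) : (forall i, 0 <= x 0 i) ->
  exists T c, [/\ T \in L, {in T, forall w, 0 <= c w} & x = lin_comb c T].
Proof.
move=> x0; set m := \sum_i x 0 i.
have m0 : 0 <= m by apply: sumr_ge0.
have [mE|mN] := eqVneq m 0.
  exists fset0, (fun=> 0); split=> //; first by case: cL.
  rewrite lin_comb0; apply/rowP => i; rewrite mxE; apply/eqP.
  have/eqP := mE; rewrite /m psumr_eq0 //.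
  by move=> /allP /(_ i (mem_index_enum _)).
have : std_simplex (m^-1 *: x).
  split=> [i|]; first by rewrite mxE mulr_ge0 // invr_ge0.
  by under eq_bigr do rewrite mxE; rewrite -mulr_sumr mulVf.
rewrite -(triang_cover hL) => -[T /= TL [c [c0 _ xE]]].
exists T, (fun w => m * c w + 0 * 0); split=> // [w wT|].
  by rewrite mul0r addr0 mulr_ge0 ?c0.
rewrite (lin_comb_linear m 0 c (fun=> 0)) scale0r addr0 /lin_comb -xE scalerA mulfV //.
by rewrite scale1r.
Qed.

(** The direction lies on no proper face of a full cone and on no cone of smaller
    dimension, even after passing to linear spans. *)
Definition generic_dir (d : 'rV[R]_k.+1) :=
  forall T c, T \in L -> d = lin_comb c T -> #|` T| = k.+1 /\ {in T, forall w, c w != 0}.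

Lemma generic_dirN d : generic_dir d -> generic_dir (- d).
Proof.
move=> gd T c TL dE.
have [|-> cn] := gd T (fun w => (-1) * c w + 0 * 0) TL.
  by rewrite (lin_comb_linear (-1) 0 c (fun=> 0)) -dE scale0r addr0 scaleN1r opprK.
by split=> // w /cn; rewrite mul0r addr0 mulN1r oppr_eq0.
Qed.

(** Any e below 1 / sum |c w| works; 1 is added to avoid dividing by 0. *)
Lemma small_step c s : exists2 e : R, 0 < e &
  forall x, 0 < x -> x <= e -> {in s, forall w, 0 < 1 + x * c w}.
Proof.
pose m := \sum_(w <- s) `|c w|.
have m0 : 0 <= m by apply: sumr_ge0.
have h : 0 < 1 + m by lra.
exists (1 + m)^-1 => [|x x0 xe w ws]; first by rewrite invr_gt0; lra.
have wm : `|c w| <= m.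
  by rewrite /m (big_fsetD1 w) //= lerDl sumr_ge0.
have xm : x * (1 + m) <= 1 by rewrite -ler_pdivlMr // mul1r.
have nc := ler_norm (- c w); rewrite normrN in nc.
by nra.
Qed.

Definition vertex_sum s : 'rV[R]_k.+1 := lin_comb (fun=> 1) s.

(** The point [vertex_sum s + e *: d] has coordinate (w \in s) + e * c w at the
    vertex w of T, so for a generic d the last condition says that it lies in the
    interior of the cone over T for small e > 0. *)
Definition star_facet d s T c :=
  [/\ T \in L, d = lin_comb c T, s `<=` T & {in T, forall w, c w < 0 -> w \in s}].

Lemma vertex_sum_step x d s T c : s `<=` T -> d = lin_comb c T ->
  vertex_sum s + x *: d = lin_comb (fun w => (w \in s)%:R + x * c w) T.
Proof.
move=> sT ->; rewrite /vertex_sum (lin_comb_sub _ sT) -[X in X + _]scale1r -lin_comb_linear.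
by apply: eq_lin_comb => w _; rewrite mul1r mulr1.
Qed.

Lemma star_facet_pos d s T c : generic_dir d -> star_facet d s T c ->
  exists2 e : R, 0 < e & forall x, 0 < x -> x <= e ->
    {in T, forall w, 0 < (w \in s)%:R + x * c w}.
Proof.
move=> gd [TL dE sT cn]; have [e e0 pe] := small_step c T.
exists e => // x x0 xe w wT; have [ws|ws] := boolP (w \in s).
  exact: pe.
rewrite add0r mulr_gt0 // lt_neqAle eq_sym.
have [_ ->] := gd _ _ TL dE => //=.
by rewrite leNgt; apply: contra ws; apply: cn.
Qed.

(** For small e the point [vertex_sum s + e *: d] has only positive coordinates
    with respect to both cones, and supports are unique. *)
Lemma star_facet_unique d s T T' c c' : generic_dir d ->
  star_facet d s T c -> star_facet d s T' c' -> T = T'.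
Proof.
move=> gd.
suff H T1 T2 c1 c2 : star_facet d s T1 c1 -> star_facet d s T2 c2 -> T1 `<=` T2.
  by move=> h1 h2; apply/eqP; rewrite eqEfsubset (H _ _ _ _ h1 h2) (H _ _ _ _ h2 h1).
move=> S1 S2; have [e1 e10 p1] := star_facet_pos gd S1.
have [e2 e20 p2] := star_facet_pos gd S2.
case: S1 S2 => [T1L d1 s1 _] [T2L d2 s2 _]; apply/fsubsetP => w w1.
pose e := Num.min e1 e2.
have e0 : 0 < e by rewrite lt_min e10.
have {}p1 : {in T1, forall w, 0 < (w \in s)%:R + e * c1 w}.
  by apply: p1; rewrite // ge_min lexx.
have {}p2 : {in T2, forall w, 0 < (w \in s)%:R + e * c2 w}.
  by apply: p2; rewrite // ge_min lexx orbT.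
apply: (cone_inter (a := fun w => (w \in s)%:R + e * c1 w)
  (b := fun w => (w \in s)%:R + e * c2 w) T1L T2L _ _ _ w1 (p1 w w1)).
- by move=> v /p1 /ltW.
- by move=> v /p2 /ltW.
- by rewrite -(vertex_sum_step e s1 d1) -(vertex_sum_step e s2 d2).
Qed.

(** The points [vertex_sum s + e *: d] stay in the orthant for small e, and some
    cone T contains them for arbitrarily small e.  Its span then contains d, and
    letting e tend to 0 shows that T contains [vertex_sum s], hence s. *)
Lemma star_facet_exists d s : generic_dir d -> s \in L ->
  (exists2 e0, 0 < e0 &
     forall e, 0 < e -> e < e0 -> forall i, 0 <= (vertex_sum s + e *: d) 0 i) ->
  exists T c, star_facet d s T c.
Proof.
move=> gd sL [e0 e00 he0].
(* If every T missed the points for all e below a bound of its own, the points with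
   e below the smallest bound would be in no cone. *)
have [T TL inT] : exists2 T, T \in L & forall r, 0 < r -> exists e a,
    [/\ 0 < e, e < r, {in T, forall w, 0 <= a w} & vertex_sum s + e *: d = lin_comb a T].
  apply: contrapT => /forall2NP nT.
  have /(_ (enum_fset L)) [//|r r0 hr] : forall ss : seq {fset W},
    {subset ss <= L} -> exists2 r, 0 < r & forall T, T \in ss ->
     forall e a, 0 < e -> e < r -> {in T, forall w, 0 <= a w} ->
       vertex_sum s + e *: d <> lin_comb a T.
    elim=> [|T ss IH] ssL; first by exists 1.
    have [|r r0 hr] := IH; first by move=> T' T's; apply: ssL; rewrite inE T's orbT.
    have [TnL|/existsNP [r' /not_implyP [r'0 nr']]] := nT T.
      by case: TnL; apply: ssL; rewrite inE eqxx.
    exists (Num.min r r') => [|T']; first by rewrite lt_min r0.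
    rewrite inE => /orP[/eqP->|T's] e a e1; rewrite lt_min => /andP[er er'] a0 E.
      by apply: nr'; exists e, a.
    exact: (hr T' T's e a).
  have [r1 [r10 r1r r1e]] : exists r1, [/\ 0 < r1, r1 < r & r1 < e0].
    exists (Num.min r e0 / 2).
    have h : 0 < Num.min r e0 by rewrite lt_min r0.
    have hr' : Num.min r e0 <= r by rewrite ge_min lexx.
    have he' : Num.min r e0 <= e0 by rewrite ge_min lexx orbT.
    by split; lra.
  have [T [a [TL a0 E]]] := cone_cover (he0 _ r10 r1e).
  exact: (hr T TL _ a r10 r1r).
have [e [a [e_gt0 _ a0 aE]]] := inT 1 ltr01.
have [e' [a' [e'_gt0 e'e a'0 a'E]]] := inT e e_gt0.
(* d is a multiple of the difference of two points of the cone over T. *)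
pose c w := (e - e')^-1 * a w + (- (e - e')^-1) * a' w.
have ee' : e - e' != 0 by rewrite subr_eq0 gt_eqF.
have dE : d = lin_comb c T.
  rewrite lin_comb_linear -aE -a'E scaleNr -scalerBr opprD addrACA subrr add0r.
  by rewrite -scalerBl scalerA mulVf ?scale1r.
pose b w := 1 * a w + (- e) * c w.
have bE : vertex_sum s = lin_comb b T.
  by rewrite lin_comb_linear -aE -dE scale1r scaleNr addrK.
have raypos r f : vertex_sum s + r *: d = lin_comb f T -> {in T, forall w, f w = b w + r * c w}.
  move=> fE; apply: (lin_comb_inj TL); rewrite -fE bE {1}dE.
  rewrite -[lin_comb b T]scale1r -lin_comb_linear; apply: eq_lin_comb => w _.
  by rewrite mul1r.
have b0 : {in T, forall w, 0 <= b w}.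
  move=> w wT; rewrite leNgt; apply/negP => bw.
  have [r r0 pr] := small_step (fun w => c w / b w) T.
  have [r' [f [r'0 r'r f0 fE]]] := inT r r0.
  have := f0 w wT; rewrite (raypos _ _ fE w wT).
  have := pr r' r'0 (ltW r'r) w wT; rewrite -(nmulr_rlt0 _ bw) mulrDr mulr1.
  by rewrite (mulrCA (b w) r') (mulrCA (b w) (c w)) mulfV ?lt_eqF // mulr1 => /lt_geF->.
have sT : s `<=` T.
  apply/fsubsetP => w ws; apply: (cone_inter sL TL _ b0 bE ws ltr01) => v _.
  exact: ler01.
have bs : {in T, forall w, b w = (w \in s)%:R}.
  have E : lin_comb b T = lin_comb (fun w => (w \in s)%:R * 1) T.
    by rewrite -bE -(lin_comb_sub (fun=> 1) sT).
  by move=> w wT; rewrite (lin_comb_inj TL E wT) mulr1.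
exists T, c; split=> // w wT cw; apply: contraT => ws.
have [r [f [r0 _ f0 fE]]] := inT 1 ltr01.
have := f0 w wT; rewrite (raypos _ _ fE w wT) (bs w wT) (negPf ws) add0r.
by rewrite pmulr_rge0 // leNgt cw.
Qed.

Lemma dependent_lin_comb s (m : nat) (x : W -> 'rV[R]_m) : (m < #|` s|)%N ->
  exists2 c : W -> R, \sum_(w <- s) c w *: x w = 0 & exists2 w, w \in s & c w != 0.
Proof.
move=> ms; have [s0|[w0 w0s]] := fset_0Vmem s; first by rewrite s0 cardfs0 in ms.
pose n := #|` s|; pose v (i : nat) := nth w0 s i.
pose M : 'M[R]_(n, m) := \matrix_(i < n) x (v i).
have : kermx M != 0.
  by rewrite -mxrank_eq0 mxrank_ker subn_eq0 -ltnNge (leq_ltn_trans (rank_leq_col _)).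
case/rowV0Pn => y /sub_kermxP yM y0.
exists (fun w => \sum_(i < n | v i == w) y 0 i).
  rewrite (big_nth w0) big_mkord; apply: etrans yM.
  rewrite mulmx_sum_row; apply: eq_bigr => i _.
  rewrite rowK; congr (_ *: _); rewrite (big_pred1 i) // => j /=.
  by rewrite /v nth_uniq // ?fset_uniq.
case/rV0Pn: y0 => i yi; exists (v i); first exact: mem_nth.
rewrite (big_pred1 i) // => j /=.
by rewrite /v nth_uniq // ?fset_uniq.
Qed.

Lemma face_card_le s : s \in L -> (#|` s| <= k.+1)%N.
Proof.
move=> sL; rewrite leqNgt; apply/negP => /(dependent_lin_comb pos)[c c0 [w ws]].
by rewrite (lin_comb_indep sL c0 ws) eqxx.
Qed.

Lemma annihilator s : (#|` s| < k.+1)%N ->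
  exists2 y : 'rV[R]_k.+1, y != 0 &
    forall c, \sum_i lin_comb c s 0 i * y 0 i = 0.
Proof.
move=> sk; have [s0|[w0 w0s]] := fset_0Vmem s.
  exists (delta_mx 0 0) => [|c].
    by apply/rV0Pn; exists 0; rewrite mxE !eqxx oner_eq0.
  by rewrite s0 lin_comb0 big1 // => i _; rewrite mxE mul0r.
pose n := #|` s|; pose v (i : nat) := nth w0 s i.
pose M : 'M[R]_(n, k.+1) := \matrix_(i < n) pos (v i).
have : kermx M^T != 0.
  by rewrite -mxrank_eq0 mxrank_ker subn_eq0 -ltnNge (leq_ltn_trans (rank_leq_col _)).
case/rowV0Pn => y /sub_kermxP yM y0; exists y => // c.
under eq_bigr do rewrite lin_combE mulr_suml.
rewrite exchange_big /= (big_nth w0) big_mkord big1 // => i _.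
have : (y *m M^T) 0 i = 0 by rewrite yM mxE.
rewrite mxE => yi; rewrite -[RHS](mulr0 (c (v i))) -[in RHS]yi mulr_sumr.
by apply: eq_bigr => j _; rewrite !mxE -mulrA [y 0 j * _]mulrC.
Qed.

(** A linear form vanishes at the point with parameter t of the moment curve only
    if t is a root of the polynomial with the same coefficients; so finitely many
    proper subspaces meet the curve in finitely many points. *)
Definition moment (t : R) : 'rV[R]_k.+1 := \row_i t ^+ i.

Lemma moment_avoid (ss : seq {fset W}) :
  {in ss, forall s, (#|` s| < k.+1)%N} ->
  exists2 p : {poly R}, p != 0 &
    forall s c (t : R), s \in ss -> moment t = lin_comb c s -> root p t.
Proof.
elim: ss => [|s ss IH] ssk; first by exists 1; rewrite ?oner_eq0.
have [s' ?|p p0 hp] := IH; first by apply: ssk; rewrite inE orbC; apply/orP; left.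
have [|y y0 hy] := @annihilator s; first by apply: ssk; rewrite inE eqxx.
(* The second factor is the linear form y along the moment curve. *)
exists (p * \poly_(i < k.+1) y 0 (inord i)) => [|s' c t].
  rewrite mulf_neq0 //; case/rV0Pn: y0 => i yi.
  apply: contraNneq yi => /(congr1 (fun q : {poly R} => q`_i)).
  by rewrite coef_poly ltn_ord coef0 inord_val => ->.
rewrite inE rootM => /orP[/eqP-> tE|s's /(hp _ _ _ s's)->//].
apply/orP; right; rewrite /root horner_poly; apply/eqP; apply: etrans (hy c).
by rewrite -tE; apply: eq_bigr => i _; rewrite mxE inord_val mulrC.
Qed.

Lemma exists_nonroot (p : {poly R}) : p != 0 -> exists2 t : R, 0 < t & ~~ root p t.
Proof.
move=> p0; apply: contrapT => /forall2NP h.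
pose rs : seq R := [seq i.+1%:R | i <- iota 0 (size p)].
have rs_root : all (root p) rs.
  apply/allP => _ /mapP[i _ ->]; have [|/negP] := h i.+1%:R.
    by rewrite ltr0n.
  by rewrite negbK.
have rs_uniq : uniq rs.
  by rewrite map_inj_uniq ?iota_uniq // => i j /eqP; rewrite eqr_nat => /eqP[].
by have := max_poly_roots p0 rs_root rs_uniq; rewrite size_map size_iota ltnn.
Qed.

Lemma exists_generic : exists2 q : 'rV[R]_k.+1, forall i, 0 < q 0 i & generic_dir q.
Proof.
have [|p p0 hp] := @moment_avoid [seq s <- L | (#|` s| < k.+1)%N].
  by move=> s; rewrite mem_filter => /andP[].
have [t t0 pt] := exists_nonroot p0.
exists (moment t) => [i|T c TL tE]; first by rewrite mxE exprn_gt0.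
have card s a : s \in L -> moment t = lin_comb a s -> #|` s| = k.+1.
  move=> sL sE; apply/eqP; rewrite eqn_leq face_card_le //=.
  rewrite leqNgt; apply: contra pt => sk; apply: hp sE.
  by rewrite mem_filter sk.
split=> [|w wT]; first exact: card TL tE.
apply/eqP => cw; have TwL : T `\ w \in L.
  by case: cL => _ /(_ T (T `\ w) TL); apply; apply: fsubD1set.
have := cardfsD1 w T; rewrite (card _ _ TL tE) wT.
rewrite (card (T `\ w) c) //; first by rewrite add1n => /eqP; rewrite eqn_leq ltnn andbF.
by rewrite tE /lin_comb (big_fsetD1 w) //= cw scale0r add0r.
Qed.

End Fan.

(** * The boundary of the triangulation and reciprocity *)

Section Ball.
Context {R : realType} {k : nat} {W : choiceType}.
Context (L : {fset {fset W}}) (pos : W -> 'rV[R]_k.+1).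
Hypothesis hL : simplex_triangulation L pos.
Hypothesis hbd : no_new_boundary_vertices L pos.
Hypothesis hint : interior_vertices L pos <> fset0.
Hypothesis hk : (1 <= k)%N.
Implicit Types (s t T : {fset W}) (c a b : W -> R) (w : W).

Let cL : is_complex L := triang_complex hL.
Local Notation bd := (boundary_complex L pos).
Local Notation B := (boundary_vertices L pos).

Lemma conv_simplex s x : s \in L -> conv_hull pos s x -> std_simplex x.
Proof. by move=> sL cx; rewrite -(triang_cover hL); exists s. Qed.

(** If every coordinate is positive at some vertex of s, then the barycenter of s
    lies in the interior of the simplex. *)
Lemma boundary_complexP s : s \in L ->
  reflect (exists i, {in s, forall w, pos w 0 i = 0}) (s \in bd).
Proof.
move=> sL; rewrite /boundary_complex !inE /= sL /=; apply: (iffP (asboolP _)).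
  move=> sub; apply: contrapT => /forallNP h.
  have pos_gt0 i : 0 < \sum_(w <- s) pos w 0 i.
    rewrite lt_neqAle big_seq sumr_ge0 ?andbT => [|w]; last exact: (pos_ge0 hL).
    rewrite -big_seq; apply/eqP => e0; apply: (h i).
    by apply: sum_ge0_eq0 => // w; apply: (pos_ge0 hL).
  pose n : R := (#|` s|)%:R.
  have n0 : n != 0.
    rewrite pnatr_eq0 cardfs_eq0; apply/eqP => s0.
    by have := pos_gt0 0; rewrite s0 big_seq_fset0 ltxx.
  have cx : conv_hull pos s (lin_comb pos (fun=> n^-1) s).
    exists (fun=> n^-1); split=> // [w _|]; first by rewrite invr_ge0 ler0n.
    by rewrite big_const_seq count_predT iter_addr_0 -mulr_natr mulVf.
  have [_ []] := sub _ cx; split=> [|i]; first exact: conv_simplex cx.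
  by rewrite lin_combE -mulr_sumr mulr_gt0 // invr_gt0 lt_neqAle eq_sym n0 ler0n.
case=> i h x cx; split; first exact: conv_simplex cx.
case=> _ /(_ i); case: cx => c [_ _ ->]; rewrite -/(lin_comb pos c s) lin_combE.
by rewrite big1_fset ?ltxx // => w ws _; rewrite h ?mulr0.
Qed.

Lemma pos_inj : {in vertices L &, injective pos}.
Proof.
move=> w w'; rewrite !(mem_vertices _ cL) => wL w'L e; apply/fset1P.
apply: (@cone_inter _ _ _ _ _ hL [fset w] _ (fun=> 1) (fun=> 1)) => //.
- by rewrite /lin_comb !big_seq_fset1 e.
- exact: fset11.
Qed.

(** A unit vector is extremal in the orthant, so every vertex occurring with a
    positive coefficient in it is a multiple of it. *)
Lemma unit_vertex_exists (i : 'I_k.+1) :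
  exists w, (w \in vertices L) && (pos w == delta_mx 0 i).
Proof.
have [|T [c [TL c0 e]]] := cone_cover hL (x := delta_mx 0 i).
  by move=> j; rewrite mxE ler0n.
have h0 m : m != i -> {in T, forall w, c w * pos w 0 m = 0}.
  move=> mi; apply: sum_ge0_eq0 => [w wT|].
    by rewrite mulr_ge0 ?c0 // (pos_ge0 hL m TL).
  by rewrite -lin_combE -e mxE eqxx (negPf mi).
have [w wT cw] : exists2 w, w \in T & c w != 0.
  apply: contrapT => /forall2NP h.
  have : (delta_mx 0 i : 'rV[R]_k.+1) 0 i = 0.
    rewrite e lin_combE big1_fset // => w wT _; have [//|/negP] := h w.
    by rewrite negbK => /eqP->; rewrite mul0r.
  by rewrite mxE !eqxx => /eqP; rewrite oner_eq0.
have wL : w \in vertices L by apply: (fsubsetP (sub_vertices TL)).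
exists w; rewrite wL /=; have [_ sum1] := pos_simplex hL wL.
have pm m : m != i -> pos w 0 m = 0.
  by move=> /h0 /(_ w wT) /eqP; rewrite mulf_eq0 (negPf cw) => /eqP.
apply/eqP/rowP => m; rewrite mxE eqxx /=; have [->|mi] := eqVneq m i; last exact: pm.
rewrite (bigD1 i) //= big1 in sum1; last by move=> j; apply: pm.
by rewrite addr0 in sum1.
Qed.

Definition unit_vertex i : W := xchoose (unit_vertex_exists i).

Lemma unit_vertexP i : unit_vertex i \in vertices L /\ pos (unit_vertex i) = delta_mx 0 i.
Proof. by have /andP[? /eqP] := xchooseP (unit_vertex_exists i). Qed.

Lemma exists_other (i : 'I_k.+1) : exists m : 'I_k.+1, m != i.
Proof.
have [->|i0] := eqVneq i ord0; last by exists ord0; rewrite eq_sym.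
by exists ord_max; rewrite -val_eqE /= -lt0n.
Qed.

Lemma boundary_vertexP w :
  reflect (exists i, w = unit_vertex i) (w \in B).
Proof.
apply: (iffP idP) => [/bigfcupP[s /andP[sbd _] ws]|[i ->]].
  have sL : s \in L by move: sbd; rewrite !inE => /andP[].
  have [i hi] := boundary_complexP sL sbd.
  have wL : w \in vertices L by apply: (fsubsetP (sub_vertices sL)).
  have [|m pm] := hbd wL.
    split; first exact: (pos_simplex hL).
    by case=> _ /(_ i); rewrite hi // ltxx.
  have [uL um] := unit_vertexP m.
  by exists m; apply: pos_inj => //; rewrite um.
have [uL um] := unit_vertexP i.
have uL' : [fset unit_vertex i] \in L by rewrite -mem_vertices.
apply/bigfcupP; exists [fset unit_vertex i]; last exact: fset11.
rewrite andbT; apply/(boundary_complexP uL').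
have [m mi] := exists_other i.
by exists m => v /fset1P ->; rewrite um mxE (negPf mi) andbF.
Qed.

Lemma unit_vertex_inj : injective unit_vertex.
Proof.
move=> i j ij; have [_ pi] := unit_vertexP i; have [_ pj] := unit_vertexP j.
have : (delta_mx 0 i : 'rV[R]_k.+1) 0 i = (delta_mx 0 j : 'rV[R]_k.+1) 0 i.
  by rewrite -pi -pj ij.
by rewrite !mxE !eqxx /=; case: eqP => // _ /eqP; rewrite oner_eq0.
Qed.

Lemma boundary_verticesE : B = [fset unit_vertex i | i in 'I_k.+1].
Proof.
apply/fsetP => w; apply/boundary_vertexP/imfsetP => [[i ->]|[i _ ->]].
  by exists i.
by exists i.
Qed.

Lemma card_boundary_vertices : #|` B| = k.+1.
Proof.
rewrite boundary_verticesE card_imfset /=; last exact: unit_vertex_inj.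
by rewrite -cardE card_ord.
Qed.

Lemma boundary_vertices_sub : B `<=` vertices L.
Proof.
by apply/fsubsetP => w /boundary_vertexP[i ->]; have [] := unit_vertexP i.
Qed.

Lemma mem_interior_vertices w :
  (w \in interior_vertices L pos) = (w \in vertices L) && (w \notin B).
Proof.
rewrite !inE /=; have [wL|//] := boolP (w \in vertices L); rewrite /=.
have wL' : [fset w] \in L by rewrite -mem_vertices.
apply/asboolP/idP => [[_ wi]|wB].
  apply/negP => /boundary_vertexP[i wE]; have [_ pw] := unit_vertexP i.
  have [m mi] := exists_other i.
  by have := wi m; rewrite wE pw mxE (negPf mi) andbF ltxx.
split=> [|i]; first exact: (pos_simplex hL).
rewrite lt_neqAle eq_sym (pos_ge0 hL i wL' (fset11 w)) andbT.
apply: contra wB => /eqP wi; apply/bigfcupP; exists [fset w]; last exact: fset11.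
by rewrite andbT; apply/(boundary_complexP wL'); exists i => v /fset1P ->.
Qed.

(** Otherwise the simplex spanned by the original vertices would be the whole space
    and would contain an interior vertex of L. *)
Lemma boundary_vertices_notin : B \notin L.
Proof.
apply/negP => BL; apply: hint; apply/fsetP => w; rewrite in_fset0.
apply/negP; rewrite mem_interior_vertices => /andP[wL /negP]; apply.
have wL' : [fset w] \in L by rewrite -mem_vertices.
have [w0 _] := pos_simplex hL wL.
apply: (@cone_inter _ _ _ _ _ hL [fset w] B (fun=> 1)
  (fun v => \sum_i pos w 0 i * pos v 0 i)) => //.
- by move=> v vB; apply: sumr_ge0 => i _; rewrite mulr_ge0 ?w0 ?(pos_ge0 hL i BL).
- rewrite /lin_comb big_seq_fset1 scale1r boundary_verticesE big_imfset /=; last first.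
    by move=> i j _ _; apply: unit_vertex_inj.
  rewrite big_enum /= [LHS]row_sum_delta; apply: eq_bigr => i _.
  have [_ ->] := unit_vertexP i; congr (_ *: _).
  rewrite (bigD1 i) //= big1 ?addr0 => [|j ji]; first by rewrite mxE !eqxx mulr1.
  by rewrite mxE (negPf ji) andbF mulr0.
- exact: fset11.
Qed.

(** A proper subset s of the original vertices lies in a coordinate hyperplane, and
    the cone T containing the sum of s meets that hyperplane only in boundary
    vertices, that is in unit vectors.  These must include all of s, so s is a face
    of T. *)
Lemma mem_boundary_complex s : (s \in bd) = (s `<` B).
Proof.
apply/idP/idP => [sbd|].
  have sL : s \in L by move: sbd; rewrite !inE => /andP[].
  rewrite fproperEneq (sub_vertices sbd) andbT.
  by apply: contraTneq sL => ->; apply: boundary_vertices_notin.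
rewrite fproperE => /andP[sB /fsubsetPn[u /boundary_vertexP[i ->] us]].
have usE w : w \in s -> exists2 m, w = unit_vertex m & m != i.
  move=> ws; have /boundary_vertexP[m wE] := fsubsetP sB _ ws; exists m => //.
  by apply: contraNneq us => <-; rewrite -wE.
have pi0 : {in s, forall w, pos w 0 i = 0}.
  move=> w /usE[m -> mi]; have [_ ->] := unit_vertexP m.
  by rewrite mxE eq_sym (negPf mi) andbF.
suff sL : s \in L by apply/(boundary_complexP sL); exists i.
have [|T [c [TL c0 e]]] := cone_cover hL (x := lin_comb pos (fun=> 1) s).
  move=> m; rewrite lin_combE big_seq sumr_ge0 // => w /usE[m' -> _].
  by rewrite mul1r; have [_ ->] := unit_vertexP m'; rewrite mxE ler0n.
have TB : {in T, forall w, c w != 0 -> w \in B}.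
  have ci : {in T, forall w, c w * pos w 0 i = 0}.
    apply: sum_ge0_eq0 => [w wT|]; first by rewrite mulr_ge0 ?c0 ?(pos_ge0 hL i TL).
    by rewrite -lin_combE -e lin_combE big1_fset // => w ws _; rewrite pi0 ?mulr0.
  move=> w wT cw; have wL : w \in vertices L by apply: (fsubsetP (sub_vertices TL)).
  apply: contraT => wB; have : w \in interior_vertices L pos.
    by rewrite mem_interior_vertices wL.
  rewrite !inE /= => /andP[_ /asboolP[_ /(_ i)]].
  by have /eqP := ci w wT; rewrite mulf_eq0 (negPf cw) /= => /eqP->; rewrite ltxx.
have [_ /(_ T s TL)] := cL; apply; apply/fsubsetP => w ws.
have [m wE _] := usE w ws; have [_ pm] := unit_vertexP m.
have : 0 < lin_comb pos c T 0 m.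
  rewrite -e lin_combE (big_fsetD1 w) //= wE pm mxE !eqxx mulr1 ltr_pwDl //.
  rewrite big_seq sumr_ge0 // => v; rewrite !inE => /andP[_ /usE[m' -> _]].
  by rewrite mul1r; have [_ ->] := unit_vertexP m'; rewrite mxE ler0n.
apply: contraTT => wT; rewrite lin_combE big1_fset ?ltxx // => v vT _.
have [->|cv] := eqVneq (c v) 0; first by rewrite mul0r.
have /boundary_vertexP[m' vE] := TB v vT cv; have [_ pm'] := unit_vertexP m'.
rewrite vE pm' mxE eqxx /=; have [mm'|_] := eqVneq m m'; last by rewrite mulr0.
by rewrite wE mm' -vE vT in wT.
Qed.

Section Facets.
Variable q : 'rV[R]_k.+1.
Hypothesis q_gt0 : forall i, 0 < q 0 i.
Hypothesis q_gen : generic_dir L pos q.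

(** The coordinates of q with respect to T; the value 0 is a default for the T whose
    span does not contain q. *)
Definition chart T : W -> R :=
  if pselect (exists c, q = lin_comb pos c T) is left e then sval (cid e) else fun=> 0.

Definition facets : {fset {fset W}} := [fset T in L | `[< q = lin_comb pos (chart T) T >]].

Lemma facetsP T : T \in facets -> T \in L /\ q = lin_comb pos (chart T) T.
Proof. by rewrite !inE => /andP[TL /asboolP]. Qed.

Lemma mem_facets T c : T \in L -> q = lin_comb pos c T ->
  T \in facets /\ {in T, c =1 chart T}.
Proof.
move=> TL qE.
have qE' : q = lin_comb pos (chart T) T.
  rewrite /chart; case: pselect => [e|[]]; last by exists c.
  exact: svalP (cid e).
split; last by apply: (lin_comb_inj hL TL); rewrite -qE.
by rewrite !inE /= TL; apply/asboolP.
Qed.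

Definition neg_part T := [fset w in T | chart T w < 0].
Definition pos_part T := [fset w in T | 0 < chart T w].

Lemma facet_signs T w : T \in facets -> w \in T ->
  (w \in pos_part T) = (w \notin neg_part T).
Proof.
move=> /facetsP[TL qE] wT; rewrite !inE /= wT /=.
by have [_ /(_ w wT)] := q_gen TL qE; case: ltgtP.
Qed.

Lemma card_facet T : T \in facets -> #|` T| = k.+1.
Proof. by move=> /facetsP[TL qE]; have [] := q_gen TL qE. Qed.

Lemma star_facet_neg_part s T c : star_facet L pos q s T c ->
  T \in facets /\ (neg_part T `<=` s) && (s `<=` T).
Proof.
move=> [TL qE sT cs]; have [TF cE] := mem_facets TL qE; split=> //.
rewrite sT andbT; apply/fsubsetP => w; rewrite !inE /= => /andP[wT cw].
by apply: cs => //; rewrite cE.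
Qed.

Lemma neg_part_star_facet s T : T \in facets -> (neg_part T `<=` s) && (s `<=` T) ->
  star_facet L pos q s T (chart T).
Proof.
move=> /facetsP[TL qE] /andP[/fsubsetP Ns sT]; split=> // w wT cw.
by apply: Ns; rewrite !inE /= wT.
Qed.

Lemma lin_combN c T : lin_comb pos (fun w => - c w) T = - lin_comb pos c T.
Proof. by rewrite /lin_comb -sumrN; apply: eq_bigr => w _; rewrite scaleNr. Qed.

Lemma star_facet_pos_part s T c : star_facet L pos (- q) s T c ->
  T \in facets /\ (pos_part T `<=` s) && (s `<=` T).
Proof.
move=> [TL qE sT cs].
have qE' : q = lin_comb pos (fun w => - c w) T by rewrite lin_combN -qE opprK.
have [TF cE] := mem_facets TL qE'; split=> //.
rewrite sT andbT; apply/fsubsetP => w; rewrite !inE /= => /andP[wT cw].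
by apply: cs => //; rewrite -oppr_gt0 cE.
Qed.

Lemma pos_part_star_facet s T : T \in facets -> (pos_part T `<=` s) && (s `<=` T) ->
  star_facet L pos (- q) s T (fun w => - chart T w).
Proof.
move=> /facetsP[TL qE] /andP[/fsubsetP Ns sT]; split=> //.
  by rewrite lin_combN -qE.
by move=> w wT cw; apply: Ns; rewrite !inE /= wT -oppr_lt0.
Qed.

(** The direction q is positive, so that a small step along q from any face stays in
    the orthant. *)
Lemma weight_sum_facets (A : comNzRingType) (g : W -> A) :
  weight_sum g L =
  \sum_(T <- facets) \prod_(w <- T) (if w \in neg_part T then g w else g w + 1).
Proof.
apply: weight_sum_partition => [T _|T s TF _ sT|s sL|s T T' _ TF T'F Ts T's].
- exact: fset_sub.
- by have [TL _] := facetsP TF; case: cL => _ h; apply: h TL sT.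
- have [|T [c /star_facet_neg_part[TF Ts]]] := star_facet_exists hL q_gen sL.
    exists 1 => // e e0 _ i; rewrite mxE addr_ge0 //; last first.
      by rewrite mxE mulr_ge0 ?ltW.
    rewrite lin_combE big_seq sumr_ge0 // => w ws.
    by rewrite mul1r (pos_ge0 hL i sL).
  by exists T.
- apply: (star_facet_unique hL q_gen).
    exact: neg_part_star_facet TF Ts.
  exact: neg_part_star_facet T'F T's.
Qed.

(** A small step along - q stays in the orthant exactly when it starts from an
    interior face: at a boundary face some coordinate vanishes and would become
    negative. *)
Lemma weight_sum_interior_facets (A : comNzRingType) (g : W -> A) :
  weight_sum g (L `\` bd) =
  \sum_(T <- facets) \prod_(w <- T) (if w \in pos_part T then g w else g w + 1).
Proof.
have gN := generic_dirN q_gen.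
apply: weight_sum_partition => [T _|T s TF Ps sT|s|s T T' _ TF T'F Ts T's].
- exact: fset_sub.
- have [TL _] := facetsP TF.
  have sL : s \in L by case: cL => _ h; apply: h TL sT.
  rewrite !in_fsetD sL andbT; apply/negP => /(boundary_complexP sL)[i si].
  have S := pos_part_star_facet TF (introT andP (conj Ps sT)).
  have [e e0 /(_ e e0 (lexx _)) pe] := star_facet_pos gN S.
  have [_ qE _ _] := S.
  have : (vertex_sum pos s + e *: - q) 0 i < 0.
    by rewrite mxE lin_combE big1_fset ?add0r ?mxE ?mxE ?mulrN ?oppr_lt0 ?mulr_gt0 // => w ws _; rewrite si ?mulr0.
  rewrite (vertex_sum_step _ sT qE) lin_combE big_seq ltNge sumr_ge0 // => w wT.
  by rewrite mulr_ge0 ?(pos_ge0 hL i TL) // ltW // pe.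
- rewrite in_fsetD => /andP[sbd sL].
  have b_gt0 i : 0 < vertex_sum pos s 0 i.
    rewrite lin_combE lt_neqAle big_seq sumr_ge0 ?andbT => [|w ws]; last first.
      by rewrite mul1r (pos_ge0 hL i sL).
    rewrite -big_seq; apply: contra sbd => /eqP e0; apply/(boundary_complexP sL); exists i.
    move=> w ws; rewrite -[LHS]mul1r; move: w ws; apply: sum_ge0_eq0 => [w ws|//].
    by rewrite mul1r (pos_ge0 hL i sL).
  have [|T [c /star_facet_pos_part[TF Ts]]] := star_facet_exists hL gN sL.
    (* For e < 1 / m every coordinate of e q is below that of the vertex sum. *)
    pose m := \sum_i q 0 i / vertex_sum pos s 0 i.
    have m_ge i : q 0 i / vertex_sum pos s 0 i <= m.
      rewrite /m (bigD1 i) //= lerDl sumr_ge0 // => j _.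
      by rewrite divr_ge0 ?ltW.
    have m0 : 0 < m.
      apply: lt_le_trans (m_ge 0); by rewrite divr_gt0.
    exists m^-1; rewrite ?invr_gt0 // => e e0 em i.
    rewrite mxE mxE mxE mulrN subr_ge0.
    have : e * (q 0 i / vertex_sum pos s 0 i) <= 1.
      apply: le_trans (_ : e * m <= 1); first by rewrite ler_pM2l.
      by rewrite -ler_pdivlMr // mul1r ltW.
    by rewrite mulrA ler_pdivrMr // mul1r.
  by exists T.
- apply: (star_facet_unique hL gN).
    exact: pos_part_star_facet TF Ts.
  exact: pos_part_star_facet T'F T's.
Qed.

End Facets.

(** In the product attached to T the factors g w and g w + 1 trade places, up to
    sign, under g |-> - 1 - g; and T has k + 1 vertices. *)
Lemma weight_sum_reciprocity (A : comNzRingType) (g : W -> A) :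
  weight_sum (fun w => - 1 - g w) (L `\` bd) = (- 1) ^+ k.+1 * weight_sum g L.
Proof.
have [q q_gt0 q_gen] := exists_generic hL.
rewrite (weight_sum_interior_facets q_gt0 q_gen) (weight_sum_facets q_gt0 q_gen).
rewrite mulr_sumr; apply: eq_fbigr => T TF _.
rewrite -(card_facet q_gen TF) -(face_weight_const (g := fun=> -1)) //.
rewrite /face_weight -big_split /=; apply: eq_fbigr => w wT _.
rewrite (facet_signs q_gen TF wT) if_neg; case: ifP => _; ring.
Qed.

End Ball.

(** * One subdivision step *)

Lemma mem_link (V : choiceType) (K : {fset {fset V}}) (s t : {fset V}) :
  (t \in link K s) = [&& t \in K, [disjoint s & t]%fset & s `|` t \in K].
Proof. by rewrite !inE. Qed.

Lemma sub_complex (V : choiceType) (K : {fset {fset V}}) (s t : {fset V}) :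
  is_complex K -> s \in K -> t `<=` s -> t \in K.
Proof. by case=> _ h; apply: h. Qed.

Lemma star_linkE (V : choiceType) (K : {fset {fset V}}) (s : {fset V}) :
  is_complex K ->
  [fset s `|` (t : {fset V}) | t in link K s] = [fset t in K | s `<=` t].
Proof.
move=> cK; apply/fsetP => x; rewrite ![RHS]inE /=; apply/imfsetP/andP.
  by case=> t; rewrite /= mem_link => /and3P[_ _ stK] ->; rewrite fsubsetUl.
case=> xK sx; exists (x `\` s) => /=; last by rewrite fsetUDl fsetDv fsetD0 (fsetUidPr _ _ sx).
rewrite mem_link (sub_complex cK xK) ?fsubsetDl //= (_ : s `|` _ = x).
  by rewrite xK andbT; apply/fdisjointP => v vs; rewrite inE vs.
by apply/fsetP => v; rewrite !inE; case vs: (v \in s); rewrite //= (fsubsetP sx).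
Qed.

Lemma star_linkK (V : choiceType) (K : {fset {fset V}}) (s t : {fset V}) :
  t \in link K s -> (s `|` t) `\` s = t.
Proof.
rewrite mem_link fdisjoint_sym => /and3P[_ /fsetDidPl d _].
by rewrite fsetDUl fsetDv fset0U.
Qed.

(** The star of s is the join of s with its link. *)
Lemma big_star (V : choiceType) (A : nmodType) (K : {fset {fset V}}) (s : {fset V})
    (F : {fset V} -> A) : is_complex K ->
  \sum_(x <- [fset x in K | s `<=` x]) F x = \sum_(t <- link K s) F (s `|` t).
Proof.
move=> cK; rewrite -star_linkE // big_imfset //= => t1 t2 /star_linkK t1E /star_linkK t2E e.
by rewrite -t1E -t2E e.
Qed.

Section Step.
Context {V W : choiceType} (L : {fset {fset W}}) (B : {fset W}).
Context (K : {fset {fset V}}) (s O : {fset V}) (iota : W -> V).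
Hypothesis cL : is_complex L.
Hypothesis BL : B \notin L.
Hypothesis B0 : B != fset0.
Hypothesis BV : B `<=` vertices L.
Hypothesis cK : is_complex K.
Hypothesis iota_inj : {in vertices L &, injective iota}.
Hypothesis iotaB : iota @` B = s.
Hypothesis sO : s `<=` O.
Hypothesis iota_new : forall w, w \in vertices L -> w \notin B ->
  iota w \notin vertices K `|` O.

(** When B is the set of boundary vertices, the faces that lie in B are those of the
    boundary complex, since the latter consists of the proper subsets of B and B itself
    is no face. *)
Definition interior_faces := [fset t in L | ~~ (t `<=` B)].

Definition subdivide : {fset {fset V}} :=
  (K `\` [fset s `|` (t : {fset V}) | t in link K s])
  `|` [fset (iota @` (s' : {fset W})) `|` (t : {fset V}) | s' in L, t in link K s].

Let kept := [fset t in K | ~~ (s `<=` t)].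
Let added := [fset (iota @` (s' : {fset W})) `|` (t : {fset V})
                | s' in interior_faces, t in link K s].

Let LV (s' : {fset W}) w : s' \in L -> w \in s' -> w \in vertices L.
Proof. by move=> s'L; apply/fsubsetP/sub_vertices. Qed.

Let iota_disj (s' : {fset W}) (t : {fset V}) :
  s' \in L -> t \in link K s -> [disjoint iota @` s' & t]%fset.
Proof.
move=> s'L; rewrite mem_link => /and3P[tK /fdisjointP st _].
apply/fdisjointP => _ /imfsetP[w /= ws ->].
have [wB|wB] := boolP (w \in B).
  by apply: st; rewrite -iotaB; apply/imfsetP; exists w.
have := iota_new (LV s'L ws) wB; rewrite inE negb_or => /andP[h _].
by apply: contra h; apply/fsubsetP/sub_vertices.
Qed.

Let B_proper (s' : {fset W}) : s' \in L -> s' `<=` B -> s' `<` B.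
Proof.
by move=> s'L s'B; rewrite fproperEneq s'B andbT; apply: contraNneq BL => <-.
Qed.

Let added_new (x : {fset V}) : x \in added ->
  exists2 v, v \in x & v \notin vertices K `|` O.
Proof.
case/imfset2P => s' /=; rewrite inE /= => /andP[s'L /fsubsetPn[w ws wB]] [t _ ->].
exists (iota w); last exact: iota_new (LV s'L ws) wB.
by rewrite inE; apply/orP; left; apply/imfsetP; exists w.
Qed.

(** Gluing in a boundary face of L gives back a face of K that does not contain s,
    so only the interior faces of L contribute new faces. *)
Lemma subdivideE : subdivide = kept `|` added.
Proof.
apply/fsetP => x; rewrite /subdivide star_linkE // !inE /=.
have -> : ~~ ((x \in K) && (s `<=` x)) && (x \in K) = (x \in K) && ~~ (s `<=` x).
  by case: (x \in K); rewrite ?andbF ?andbT.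
have [//|xk] := boolP ((x \in K) && ~~ (s `<=` x)); rewrite /=.
apply/imfset2P/imfset2P => -[s' /= s'L [t tl xE]]; last first.
  by exists s'; [move: s'L; rewrite inE /= => /andP[] | exists t].
exists s'; last by exists t.
rewrite !inE /= s'L /=; apply: contra xk => s'B.
have /and3P[tK st stK] : [&& t \in K, [disjoint s & t]%fset & s `|` t \in K].
  by rewrite -mem_link.
have is's : iota @` s' `<=` s.
  by rewrite -iotaB; apply/fsubsetP => _ /imfsetP[w ws ->]; apply/imfsetP; exists w => //; apply: (fsubsetP s'B).
rewrite xE (sub_complex cK stK) ?fsetSU //=.
have := B_proper s'L s'B; rewrite fproperE => /andP[_ /fsubsetPn[w wB ws']].
have wL := fsubsetP BV w wB.
have iws : iota w \in s by rewrite -iotaB; apply/imfsetP; exists w.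
apply/fsubsetPn; exists (iota w) => //; rewrite inE negb_or.
rewrite (fdisjointP st) // andbT; apply: contra ws' => /imfsetP[w' /= w's' e].
by rewrite (iota_inj wL (LV s'L w's') e).
Qed.

Lemma kept_added_disjoint : [disjoint kept & added]%fset.
Proof.
apply/fdisjointP => x; rewrite !inE /= => /andP[xK _].
apply/negP => /added_new[v vx]; rewrite inE negb_or => /andP[/negP[]].
by apply: (fsubsetP (sub_vertices xK)).
Qed.

(** A new face contains a new vertex. *)
Lemma subdivide_old x : x \in subdivide -> x `<=` O -> x \in K /\ ~~ (s `<=` x).
Proof.
rewrite subdivideE inE => /orP[|/added_new[v vx vO] /fsubsetP xO].
  by rewrite !inE /= => /andP[].
by move: vO; rewrite inE negb_or xO // andbF.
Qed.

Lemma link_complex t u : t \in link K s -> u `<=` t -> u \in link K s.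
Proof.
rewrite !mem_link => /and3P[tK st stK] ut.
rewrite (sub_complex cK tK ut) (sub_complex cK stK) ?fsetUS // andbT /=.
exact: fdisjointWr ut st.
Qed.

Lemma subdivide_complex : is_complex subdivide.
Proof.
have s0 : ~~ (s `<=` fset0).
  case/fset0Pn: B0 => w wB; rewrite fsubset0 -iotaB.
  by apply/fset0Pn; exists (iota w); apply/imfsetP; exists w.
split=> [|x y].
  by rewrite subdivideE in_fsetU !inE /= s0; case: cK => ->.
rewrite /subdivide star_linkE // in_fsetU in_fsetD => /orP[|/imfset2P].
  rewrite !inE /= => /andP[+ xK]; rewrite xK /= => sx yx.
  rewrite (sub_complex cK xK yx) /= andbT; apply/orP; left.
  by apply: contra sx => /fsubset_trans; apply.
move=> -[s' /= s'L [t tl ->]] /fsubsetP yst; rewrite in_fsetU; apply/orP; right.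
apply/imfset2P; exists [fset w in s' | iota w \in y] => /=.
  by apply: sub_complex cL s'L _; apply: fset_sub.
exists (y `&` t); first by apply: link_complex tl _; apply: fsubsetIr.
apply/fsetP => v; rewrite in_fsetU in_fsetI; apply/idP/orP => [vy|].
  have := yst v vy; rewrite in_fsetU => /orP[/imfsetP[w /= ws vE]|->]; last by right; rewrite vy.
  by left; apply/imfsetP; exists w => //=; rewrite !inE /= ws -vE.
case=> [/imfsetP[w /= + ->]|/andP[]//].
by rewrite !inE /= => /andP[].
Qed.

(** The faces above s contribute the weight of s times the weight sum of the link;
    they are exchanged for the joins of an interior face of L with a face of the
    link.  Such a join determines both parts, as the link is disjoint from the copy
    of L. *)
Lemma weight_sum_subdivide (A : comNzRingType) (h : V -> A) :
  weight_sum h subdivide = weight_sum h K +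
    (weight_sum (h \o iota) interior_faces - face_weight h s) * weight_sum h (link K s).
Proof.
have -> : weight_sum h subdivide = weight_sum h kept + weight_sum h added.
  by rewrite /weight_sum subdivideE big_fsetU_disjoint // kept_added_disjoint.
have -> : weight_sum h K = weight_sum h kept + face_weight h s * weight_sum h (link K s).
  rewrite {1}/weight_sum (big_fsetID _ (fun x : {fset V} => ~~ (s `<=` x))) /=; congr (_ + _).
  rewrite (eq_fbigl _ (B := [fset x in K | s `<=` x])); last first.
    by move=> x; rewrite !inE /= negbK.
  rewrite big_star // mulr_sumr; apply: eq_fbigr => t.
  by rewrite mem_link => /and3P[_ d _] _; rewrite face_weightU.
have -> : weight_sum h added =
    weight_sum (h \o iota) interior_faces * weight_sum h (link K s).
  have disj (s1 s2 : {fset W}) (t1 t2 : {fset V}) v : s1 \in L -> s2 \in L ->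
      t1 \in link K s -> t2 \in link K s -> iota @` s1 `|` t1 = iota @` s2 `|` t2 ->
      v \in iota @` s1 -> v \in iota @` s2.
    move=> s1L s2L t1l t2l /fsetP e vs; have := e v; rewrite !in_fsetU vs /=.
    case/esym/orP => // vt2; case/imfsetP: (vs) => w /= ws vE.
    have [wB|wB] := boolP (w \in B).
      have vS : v \in s by rewrite -iotaB vE; apply/imfsetP; exists w.
      by move: t2l; rewrite mem_link => /and3P[_ /fdisjointP/(_ v vS)]; rewrite vt2.
    have := iota_new (LV s1L ws) wB; rewrite -vE inE negb_or => /andP[/negP[]].
    move: t2l; rewrite mem_link => /and3P[t2K _ _].
    exact: (fsubsetP (sub_vertices t2K)).
  have split_inj (s1 s2 : {fset W}) (t1 t2 : {fset V}) : s1 \in L -> s2 \in L ->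
      t1 \in link K s -> t2 \in link K s -> iota @` s1 `|` t1 = iota @` s2 `|` t2 ->
      s1 `<=` s2 /\ t1 `<=` t2.
    move=> s1L s2L t1l t2l e; split; apply/fsubsetP => w ws.
      have iw : iota w \in iota @` s1 by apply/imfsetP; exists w.
      have /imfsetP[w' /= w's e'] := disj _ _ _ _ _ s1L s2L t1l t2l e iw.
      by rewrite (iota_inj (LV s1L ws) (LV s2L w's) e').
    have /fsetP/(_ w) := e; rewrite !in_fsetU ws orbT => /esym/orP[ws2|//].
    have := disj _ _ _ _ _ s2L s1L t2l t1l (esym e) ws2.
    by move/(fdisjointP (iota_disj s1L t1l)); rewrite ws.
  rewrite /weight_sum big_imfset2 /=; last first.
    move=> [s1 t1] [s2 t2] /= /andP[]; rewrite !inE /= => /andP[s1L _] t1k.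
    move=> /andP[/andP[s2L _] t2k] e.
    have t1l : t1 \in link K s by rewrite mem_link.
    have t2l : t2 \in link K s by rewrite mem_link.
    have [s12 t12] := split_inj _ _ _ _ s1L s2L t1l t2l e.
    have [s21 t21] := split_inj _ _ _ _ s2L s1L t2l t1l (esym e).
    have -> : s1 = s2 by apply/eqP; rewrite eqEfsubset s12.
    by have -> : t1 = t2 by apply/eqP; rewrite eqEfsubset t12.
  rewrite mulr_suml; apply: eq_fbigr => s'; rewrite !inE /= => /andP[s'L _] _.
  rewrite mulr_sumr; apply: eq_fbigr => t tl _; rewrite face_weightU; last exact: iota_disj.
  congr (_ * _); rewrite /face_weight big_imfset //=.
  move=> w1 w2 w1s w2s; exact: iota_inj (LV s'L w1s) (LV s'L w2s).
ring.
Qed.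

End Step.

(** * Tchebyshev triangulations of a full simplex *)

Section Chain.
Context {W : choiceType} (L : {fset {fset W}}) (B : {fset W}).
Context (A : comNzRingType) (u v : A) (O : {fset nat}).
Hypothesis cL : is_complex L.
Hypothesis BL : B \notin L.
Hypothesis B0 : B != fset0.
Hypothesis BV : B `<=` vertices L.

(** The value r_L(u, v) of the magic polynomial. *)
Definition magic_value : A :=
  weight_sum (fun w => if w \in B then u else v) (interior_faces L B) - u ^+ #|` B|.

Definition old_weight (x : nat) : A := if x \in O then u else v.

(** The new vertices avoid O as well as K, so that old and new vertices never get
    confused, even when a vertex of O is not a vertex of K. *)
Definition fresh_step (s : {fset nat}) (K K' : {fset {fset nat}}) : Prop :=
  exists iota : W -> nat,
    [/\ {in vertices L &, injective iota}, iota @` B = s,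
        forall w, w \in vertices L -> w \notin B -> iota w \notin vertices K `|` O
      & K' = subdivide L K s iota].

Lemma fresh_step_exists (s : {fset nat}) (K : {fset {fset nat}}) :
  s `<=` O -> #|` s| = #|` B| -> exists K', fresh_step s K K'.
Proof.
move=> sO sB; pose X := vertices K `|` O.
pose N := (\max_(x <- X) x).+1.
have XN x : x \in X -> (x < N)%N.
  by move=> xX; rewrite ltnS (big_rem _ xX) /= leq_maxl.
(* B goes to s in the order of enumeration, the other vertices beyond all of X. *)
pose iota w := if w \in B then nth 0%N s (index w B) else (N + index w (vertices L))%N.
have iotaB w : w \in B -> iota w \in s.
  by rewrite /iota => wB; rewrite wB mem_nth // sB index_mem.
have iotaN w : (iota w < N)%N -> w \in B.
  by rewrite /iota; case: ifP => // _; rewrite ltnNge leq_addr.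
have BN w : w \in B -> (iota w < N)%N.
  by move=> /iotaB ws; apply: XN; rewrite inE (fsubsetP sO) ?orbT.
exists (subdivide L K s iota), iota; split=> //.
- move=> w1 w2 w1L w2L e; have [w1B|w1B] := boolP (w1 \in B).
    have w2B : w2 \in B by apply: iotaN; rewrite -e BN.
    move: e; rewrite /iota w1B w2B => /eqP.
    rewrite nth_uniq ?fset_uniq ?sB ?index_mem // => /eqP e.
    by rewrite -(nth_index w1 w1B) e nth_index.
  have w2B : w2 \notin B by apply: contra w1B => /BN; rewrite -e; apply: iotaN.
  move: e; rewrite /iota (negPf w1B) (negPf w2B) => /addnI e.
  by rewrite -(nth_index w1 w1L) e nth_index.
- apply/fsetP => x; apply/imfsetP/idP => [[w /= wB ->]|xs]; first exact: iotaB.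
  have ix : (index x s < #|` B|)%N by rewrite -sB index_mem.
  case/fset0Pn: (B0) => w0 w0B.
  have wB : nth w0 B (index x s) \in B by apply: mem_nth.
  exists (nth w0 B (index x s)) => //.
  by rewrite /iota wB index_uniq ?fset_uniq // nth_index.
- move=> w wL wB; apply/negP => /XN /iotaN; exact/negP.
Qed.

Lemma fresh_stepP (s : {fset nat}) (K K' : {fset {fset nat}}) :
  is_complex K -> s `<=` O -> #|` s| = #|` B| -> fresh_step s K K' ->
  [/\ is_complex K',
      forall x, x \in K' -> x `<=` O -> x \in K /\ ~~ (s `<=` x)
    & exists Q, weight_sum old_weight K' = weight_sum old_weight K + magic_value * Q].
Proof.
move=> cK sO sB [iota [iota_inj iotaB iota_new ->]].
split; first exact: (subdivide_complex cL BL B0 BV cK iota_inj iotaB).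
  exact: (subdivide_old BL BV cK iota_inj iotaB iota_new).
exists (weight_sum old_weight (link K s)).
rewrite (weight_sum_subdivide BL BV cK iota_inj iotaB iota_new).
congr (_ + (_ - _) * _).
  apply: eq_fbigr => t; rewrite !inE /= => /andP[tL _] _; apply: eq_fbigr => w wt _.
  rewrite /= /old_weight; have [wB|wB] := boolP (w \in B).
    by rewrite (fsubsetP sO) // -iotaB; apply/imfsetP; exists w.
  have wL := fsubsetP (sub_vertices tL) w wt.
  by have := iota_new w wL wB; rewrite inE negb_or => /andP[_ /negPf->].
rewrite -sB; apply: face_weight_const => x xs.
by rewrite /old_weight (fsubsetP sO).
Qed.

Lemma fresh_chain (ss : seq {fset nat}) (K : {fset {fset nat}}) :
  is_complex K -> {in ss, forall s, s `<=` O /\ #|` s| = #|` B|} ->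
  exists Ks : nat -> {fset {fset nat}},
  [/\ Ks 0%N = K,
      forall i, (i <= size ss)%N -> is_complex (Ks i),
      forall i, (i < size ss)%N -> fresh_step (nth fset0 ss i) (Ks i) (Ks i.+1),
      forall x, x \in Ks (size ss) -> x `<=` O ->
        x \in K /\ {in ss, forall s, ~~ (s `<=` x)}
    & exists Q, weight_sum old_weight (Ks (size ss)) =
        weight_sum old_weight K + magic_value * Q].
Proof.
elim: ss K => [|s ss IH] K cK hss.
  exists (fun=> K); split=> //; exists 0; by rewrite mulr0 addr0.
have [sO sB] : s `<=` O /\ #|` s| = #|` B| by apply: hss; rewrite inE eqxx.
have [K' stepK] := fresh_step_exists K sO sB.
have [cK' oldK [Q QE]] := fresh_stepP cK sO sB stepK.
have [|Ks [Ks0 cKs stepKs oldKs [Q' QE']]] := IH K' cK'.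
  by move=> t ts; apply: hss; rewrite inE ts orbT.
exists (fun i => if i is i'.+1 then Ks i' else K); split=> //=.
- by case=> // i; apply: cKs.
- by case=> [|i] /=; [rewrite Ks0 | apply: stepKs].
- move=> x /oldKs h xO; have [xK' ssx] := h xO; have [xK sx] := oldK x xK' xO.
  by split=> // t; rewrite inE => /orP[/eqP->//|]; apply: ssx.
- by exists (Q + Q'); rewrite QE' QE mulrDr addrA.
Qed.

Lemma fsubset_card (X : {fset nat}) n : (n <= #|` X|)%N ->
  exists2 s, s `<=` X & #|` s| = n.
Proof.
move=> nX; exists [fset x in take n (enum_fset X)].
  by apply/fsubsetP => x; rewrite !inE => /mem_take.
by rewrite card_fseq undup_id ?take_uniq ?fset_uniq // size_takel.
Qed.

Lemma full_complex : is_complex (fpowerset O).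
Proof.
split=> [|s t]; rewrite !fpowersetE ?fsub0set // => sO ts.
exact: fsubset_trans ts sO.
Qed.

(** A face with #|B| old vertices would contain one of the subdivided simplices s,
    and all faces above s were removed when s was treated and never return. *)
Lemma simplex_chain : exists ss (Ks : nat -> {fset {fset nat}}),
  [/\ uniq ss /\ (forall s, (s \in ss) = (s \in fpowerset O) && (#|` s| == #|` B|)),
      Ks 0%N = fpowerset O,
      forall i, (i <= size ss)%N -> is_complex (Ks i),
      forall i, (i < size ss)%N -> fresh_step (nth fset0 ss i) (Ks i) (Ks i.+1)
    & {in Ks (size ss), forall x, (#|` x `&` O| < #|` B|)%N} /\
      exists Q, weight_sum old_weight (Ks (size ss)) =
        (u + 1) ^+ #|` O| + magic_value * Q].
Proof.
pose ss : seq {fset nat} := [seq s <- fpowerset O | #|` s| == #|` B|].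
have mss (s : {fset nat}) : (s \in ss) = (s \in fpowerset O) && (#|` s| == #|` B|).
  by rewrite mem_filter andbC.
have [|Ks [K0 cKs stepKs oldKs [Q QE]]] := @fresh_chain ss _ full_complex.
  by move=> s; rewrite mss fpowersetE => /andP[? /eqP].
exists ss, Ks; split=> //; first by rewrite filter_uniq ?fset_uniq.
split=> [x xK|]; last first.
  exists Q; rewrite QE weight_sum_fpowerset; congr (_ + _).
  rewrite (eq_fbigr _ (G := fun=> u + 1)) => [|w wO _]; last by rewrite /old_weight wO.
  by rewrite big_const_seq count_predT iter_mulr_1.
rewrite ltnNge; apply/negP => /fsubset_card[s sx sB].
have xO : x `&` O `<=` O by apply: fsubsetIr.
have xK' := sub_complex (cKs _ (leqnn _)) xK (fsubsetIl x O).
have [_ /(_ s)] := oldKs _ xK' xO.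
by rewrite mss fpowersetE sB eqxx (fsubset_trans sx xO) sx => /(_ isT).
Qed.

End Chain.

(** * F-polynomials of links *)

Section FaceCounting.
Context {R : realType} {V : choiceType}.
Implicit Types (K : {fset {fset V}}) (s t : {fset V}).

Definition z_poly : {poly R} := 2^-1 *: ('X - 1).

Lemma Fpoly_weight_sum K : Fpoly R K = weight_sum (fun=> z_poly) K.
Proof.
rewrite /Fpoly /weight_sum.
under eq_bigr => j _.
  rewrite /face_number card_fset_sum1 natr_sum scaler_suml big_fset /= -/z_poly.
  over.
under [RHS]eq_bigr => s _ do rewrite (face_weight_const (a := z_poly)) //.
under eq_bigr => j _ do rewrite big_mkcond /=.
rewrite exchange_big /=; apply: eq_fbigr => s sK _.
have sm : (#|` s| < (max_face_card K).+1)%N.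
  by rewrite ltnS /max_face_card (big_rem s sK) /= leq_maxl.
rewrite (bigD1 (Ordinal sm)) //= eqxx scale1r big1 ?addr0 // => i im.
by rewrite ifF //; apply: contraNF im => /eqP si; rewrite -val_eqE /= si.
Qed.

(** Compare coefficients of the weight sum with all weights equal to 'X. *)
Lemma count_fpowerset s n :
  count (fun t : {fset V} => #|` t| == n) (fpowerset s) = 'C(#|` s|, n).
Proof.
apply/eqP; rewrite -(eqr_nat int) -sum1_count natr_sum; apply/eqP.
have : (weight_sum (fun=> 'X) (fpowerset s) : {poly int})`_n = (('X + 1) ^+ #|` s|)`_n.
  by rewrite weight_sum_fpowerset big_const_seq count_predT iter_mulr_1.
rewrite exprD1n coef_sum /weight_sum coef_sum => e.
transitivity (\sum_(t <- fpowerset s) ((#|` t| == n)%:R : int)).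
  by rewrite big_mkcond /=; apply: eq_bigr => t _; case: eqP.
transitivity (\sum_(t <- fpowerset s) (face_weight (fun=> 'X : {poly int}) t)`_n).
  apply: eq_bigr => t _; rewrite (face_weight_const (a := 'X)) // coefXn eq_sym.
  by [].
rewrite e; have [sn|ns] := ltnP #|` s| n.
  rewrite bin_small // big1 // => i _; rewrite coefMn coefXn.
  have /negPf-> : n != i by rewrite neq_ltn orbC (leq_trans (ltn_ord i)).
  by rewrite mul0rn.
have ns' : (n < #|` s|.+1)%N by [].
rewrite (bigD1 (Ordinal ns')) //= coefMn coefXn eqxx big1 ?addr0 // => i im.
rewrite coefMn coefXn (_ : (n == i) = false) ?mul0rn //.
by apply/negbTE; apply: contra im => /eqP ni; rewrite -val_eqE /= -ni.
Qed.

Lemma weight_sum_link K s : is_complex K ->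
  weight_sum (fun=> z_poly) (link K s) =
  \sum_(t <- K | s `<=` t) z_poly ^+ (#|` t| - #|` s|).
Proof.
move=> cK; rewrite [RHS]big_fset_condE big_star //; apply: eq_fbigr => t.
rewrite mem_link => /and3P[_ st _] _; rewrite (face_weight_const (a := z_poly)) //.
by rewrite cardfsU (eqP (etrans (fsetI_eq0 s t) st)) cardfs0 subn0 addKn.
Qed.

(** The n-th divided derivative of u^a is 'C(a, n) u^(a - n), and 'C(a, n) counts the
    n-subsets of the old vertices of a face that has a of them. *)
Lemma sum_links_nderivn K (O : {fset V}) n : is_complex K ->
  \sum_(s <- fpowerset O | #|` s| == n) Fpoly R (link K s) =
  (weight_sum (fun w => if w \in O then 'X else z_poly%:P) K)^`N(n).[z_poly].
Proof.
move=> cK; transitivity (\sum_(s <- fpowerset O | #|` s| == n)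
    \sum_(t <- K | s `<=` t) z_poly ^+ (#|` t| - n)).
  apply: eq_bigr => s /eqP sn; rewrite Fpoly_weight_sum weight_sum_link //.
  by rewrite sn.
rewrite /weight_sum linear_sum horner_sum.
rewrite big_mkcond /=; under eq_bigr do rewrite big_mkcond /=.
rewrite (eq_bigr (fun s : {fset V} => \sum_(t <- K)
   (if (#|` s| == n) && (s `<=` t) then z_poly ^+ (#|` t| - n) else 0))); last first.
  by move=> s _; case: ifP => // _; rewrite big1.
rewrite exchange_big /=; apply: eq_bigr => t _.
rewrite face_weight_mem -polyC_exp mulrC mul_polyC linearZ /= nderivnXn.
rewrite hornerZ hornerMn hornerXn mulrnAr.
set a := #|` t `&` O|; set b := #|` t `\` O|.
have ab : #|` t| = (a + b)%N by rewrite cardfsID.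
transitivity (\sum_(s <- fpowerset (t `&` O) | #|` s| == n) z_poly ^+ (#|` t| - n)).
  rewrite -big_mkcond /= -big_filter -[RHS]big_filter; apply: perm_big.
  rewrite uniq_perm ?filter_uniq ?fset_uniq // => s.
  by rewrite !mem_filter !fpowersetE fsubsetI -andbA [_ && (s `<=` O)]andbC.
rewrite big_const_seq iter_addr_0 count_fpowerset -/a.
have [an|na] := ltnP a n; first by rewrite bin_small.
by congr (_ *+ _); rewrite -exprD ab addnC addnBA.
Qed.

End FaceCounting.

(** * The map U as evaluation of a remainder *)

Section Main.
Import Pdiv.IdomainUnit.
Context {R : realType} {k : nat} {W : choiceType}.
Context (L : {fset {fset W}}) (pos : W -> 'rV[R]_k.+1).
Hypothesis hk : (1 <= k)%N.
Hypothesis hL : simplex_triangulation L pos.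
Hypothesis hbd : no_new_boundary_vertices L pos.
Hypothesis hint : interior_vertices L pos <> fset0.

Local Notation bd := (boundary_complex L pos).
Local Notation B := (boundary_vertices L pos).
Let cL : is_complex L := triang_complex hL.
Let BL : B \notin L := boundary_vertices_notin hL hbd hint hk.
Let cardB : #|` B| = k.+1 := card_boundary_vertices hL hbd hk.

Local Notation magic := (magic_value L B).

Lemma interior_facesE : L `\` bd = interior_faces L B.
Proof.
apply/fsetP => s; rewrite in_fsetD (mem_boundary_complex hL hbd hint hk).
rewrite !inE /= andbC; have [sL|//] := boolP (s \in L); rewrite /=.
by rewrite fproperEneq (_ : s != B) //; apply: contraNneq BL => <-.
Qed.

(** By [weight_sum_reciprocity] the interior part of r_L turns into the weight sum of
    all faces, which exceeds the interior part by the proper subsets of B, that is by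
    (u + 1)^(k + 1) - u^(k + 1); the first of these powers cancels. *)
Lemma magic_reciprocity (A : comNzRingType) (u v : A) :
  magic (- 1 - u) (- 1 - v) = (- 1) ^+ k.+1 * magic u v.
Proof.
pose g w := if w \in B then u else v.
have -> : magic (- 1 - u) (- 1 - v) =
    weight_sum (fun w => - 1 - g w) (L `\` bd) - (- 1 - u) ^+ k.+1.
  rewrite interior_facesE /magic_value cardB; congr (_ - _).
  apply: eq_bigr => s _; apply: eq_bigr => w _; rewrite /g.
  by case: ifP.
rewrite (weight_sum_reciprocity hL) /magic_value -interior_facesE -/g cardB.
have bdB : bd = fpowerset B `\` [fset B].
  apply/fsetP => s; rewrite (mem_boundary_complex hL hbd hint hk) in_fsetD in_fset1.
  by rewrite fpowersetE fproperEneq.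
have EB : weight_sum g bd = (u + 1) ^+ k.+1 - u ^+ k.+1.
  have <- : face_weight g B = u ^+ k.+1.
    by rewrite -cardB; apply: face_weight_const => w wB; rewrite /g wB.
  have <- : weight_sum g (fpowerset B) = (u + 1) ^+ k.+1.
    rewrite weight_sum_fpowerset (eq_fbigr _ (G := fun=> u + 1)) => [|w wB _].
      by rewrite big_const_seq count_predT iter_mulr_1 cardB.
    by rewrite /g wB.
  rewrite /weight_sum [in RHS](big_fsetD1 B) ?fpowersetE ?fsubset_refl //=.
  by rewrite addrAC subrr add0r bdB.
have -> : weight_sum g L = weight_sum g (L `\` bd) + weight_sum g bd.
  have bdI : L `&` bd = bd by apply/fsetIidPr; apply: fset_sub.
  rewrite /weight_sum -{1}(fsetID bd L) bdI fsetUC big_fsetU_disjoint //.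
  by apply/fdisjointP => s; rewrite inE => /andP[].
have -> : - 1 - u = - (u + 1) by ring.
rewrite EB [(- (u + 1)) ^+ _]exprNn; ring.
Qed.

Lemma interior_face_old s : s \in interior_faces L B -> (#|` s `&` B| < k.+1)%N.
Proof.
rewrite !inE /= => /andP[sL _]; rewrite -cardB; apply: fproper_ltn_card.
apply: fproperIr; apply: contra BL => Bs; exact: sub_complex cL sL Bs.
Qed.

Lemma size_weight_sum (A : comNzRingType) (c : A) (V : choiceType) (O : {fset V})
    (K : {fset {fset V}}) m :
  {in K, forall s, (#|` s `&` O| < m)%N} ->
  (size (weight_sum (fun w => if w \in O then 'X else c%:P) K) <= m)%N.
Proof.
move=> Km; apply/leq_sizeP => i mi; rewrite coef_sum big1_fset // => s sK _.
rewrite face_weight_mem -polyC_exp coefMC coefXn gtn_eqF ?mul0r //.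
exact: leq_trans (Km s sK) mi.
Qed.

Lemma magic_monic (A : comNzRingType) (c : A) :
  size (- magic 'X c%:P) = k.+2 /\ lead_coef (- magic 'X c%:P) = 1.
Proof.
rewrite /magic_value opprB cardB.
have small := size_weight_sum c interior_face_old.
have lt : (size (- weight_sum (fun w => if w \in B then 'X else c%:P)
    (interior_faces L B)) < size ('X ^+ k.+1 : {poly A}))%N.
  by rewrite size_polyN size_polyXn ltnS.
by rewrite size_polyDl // lead_coefDl // size_polyXn lead_coefXn.
Qed.

(** Remainder modulo r_L(u, z), where u is the outer variable 'X, followed by the n-th
    divided derivative at u = z.  The sign makes the divisor monic. *)
Definition reduced_eval n (G : {poly {poly R}}) : {poly R} :=
  ((G %% - magic 'X z_poly%:P)^`N(n)).[z_poly].

Let magic_unit : lead_coef (- magic 'X (z_poly (R := R))%:P) \is a GRing.unit.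
Proof. by rewrite (magic_monic _).2 unitr1. Qed.

Lemma reduced_evalD n F G : reduced_eval n (F + G) = reduced_eval n F + reduced_eval n G.
Proof. by rewrite /reduced_eval modpD // linearD hornerD. Qed.

Lemma reduced_evalZ n c G : reduced_eval n (c *: G) = c * reduced_eval n G.
Proof. by rewrite /reduced_eval modpZl // linearZ hornerZ. Qed.

Lemma reduced_eval0 n : reduced_eval n 0 = 0.
Proof. by rewrite -(scale0r 0) reduced_evalZ mul0r. Qed.

Lemma reduced_eval_sum n (I : Type) (r : seq I) (F : I -> {poly {poly R}}) :
  reduced_eval n (\sum_(i <- r) F i) = \sum_(i <- r) reduced_eval n (F i).
Proof.
elim: r => [|i r IH]; first by rewrite !big_nil reduced_eval0.
by rewrite !big_cons reduced_evalD IH.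
Qed.

Lemma reduced_eval_magic n G : reduced_eval n (G * magic 'X z_poly%:P) = 0.
Proof.
rewrite /reduced_eval -[G * _]opprK -mulrN -mulNr Pdiv.Idomain.modp_mull.
by rewrite linear0 horner0.
Qed.

Variables (j : nat) (U : {linear {poly R} -> {poly R}}).
Hypothesis hU : is_tchebyshev_map L pos j U.

(** The weight sum of the subdivided simplex is congruent to that of the simplex,
    (u + 1)^d, and has degree at most k in u: it is the remainder. *)
Lemma tchebyshev_map_simplex d :
  U ((2^-1 *: ('X + 1)) ^+ d) = reduced_eval (j - 1) (('X + 1) ^+ d).
Proof.
pose O : {fset nat} := [fset i in iota 0 d].
have cardO : #|` O| = d by rewrite card_fseq undup_id ?iota_uniq ?size_iota.
have B0 : B != fset0 by rewrite -cardfs_gt0 cardB.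
have BV : B `<=` vertices L := boundary_vertices_sub hL hbd hk.
have [ss [Ks [[ss_uniq mem_ss] K0 cKs stepKs [oldK [Q QE]]]]] :=
  simplex_chain ('X : {poly {poly R}}) (z_poly (R := R))%:P O cL BL B0 BV.
have tri : tchebyshev_triangulation L pos (fpowerset O) (Ks (size ss)).
  exists ss, Ks; split=> //; first by move=> s; rewrite mem_ss cardB.
  move=> i /stepKs [iota [iota_inj iotaB iota_new ->]].
  exists iota; split=> // w; rewrite (mem_interior_vertices hL hbd hk) => /andP[wL wB].
  by have := iota_new w wL wB; rewrite in_fsetU negb_or => /andP[].
have := hU.2 _ _ _ (full_complex O) tri.
rewrite Fpoly_weight_sum weight_sum_fpowerset big_const_seq count_predT iter_mulr_1 cardO.
have -> : z_poly + 1 = 2^-1 *: ('X + 1) :> {poly R}.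
  have e : 2^-1 *: (1 + 1) = 1 :> {poly R}.
    by rewrite -mulr2n -scaler_nat scalerA mulVf ?scale1r // pnatr_eq0.
  by rewrite /z_poly -{2}e -scalerDr; congr (_ *: _); ring.
move=> ->; rewrite (sum_links_nderivn O (j - 1)%N (cKs _ (leqnn _))).
rewrite /reduced_eval; congr ((_^`N(_)).[_]).
set M := magic 'X _ in QE *; set F := weight_sum _ _ in QE *.
have -> : ('X + 1) ^+ d = Q * - M + F by rewrite QE cardO; ring.
rewrite modp_addl_mul_small // (magic_monic _).1 ltnS.
by apply: size_weight_sum => s sK; rewrite -cardB; apply: oldK.
Qed.

End Main.

(** * The recurrence *)

Section Reversal.
Context {A : comNzRingType}.
Implicit Types (p y : {poly A}) (c : A).

(** y^n p(1/y), written without denominators. *)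
Definition reverse_eval n y p : {poly A} := \sum_(l < n.+1) p`_l *: y ^+ (n - l).

Lemma reverse_evalB n y p q :
  reverse_eval n y (p - q) = reverse_eval n y p - reverse_eval n y q.
Proof. by rewrite -sumrB; apply: eq_bigr => l _; rewrite coefB scalerBl. Qed.

Lemma reverse_evalZ n y c p : reverse_eval n y (c *: p) = c *: reverse_eval n y p.
Proof. by rewrite scaler_sumr; apply: eq_bigr => l _; rewrite coefZ scalerA. Qed.

Lemma reverse_eval_sum n y (I : Type) (r : seq I) (F : I -> {poly A}) :
  reverse_eval n y (\sum_(i <- r) F i) = \sum_(i <- r) reverse_eval n y (F i).
Proof.
rewrite [RHS]exchange_big /=; apply: eq_bigr => l _.
by rewrite coef_sum scaler_suml.
Qed.

Lemma reverse_eval_Xn n y m : (m <= n)%N -> reverse_eval n y 'X^m = y ^+ (n - m).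
Proof.
rewrite -ltnS => mn; rewrite /reverse_eval (bigD1 (Ordinal mn)) //= coefXn eqxx scale1r.
rewrite big1 ?addr0 // => i im; rewrite coefXn (_ : (_ == _) = false) ?scale0r //.
by apply/negbTE; apply: contra im => /eqP im; rewrite -val_eqE /= im.
Qed.

Lemma reverse_eval_term n y a : (a <= n)%N ->
  reverse_eval n y ('X^(n - a) * (1 + 'X) ^+ a) = (1 + y) ^+ a.
Proof.
move=> an; rewrite [1 + 'X]addrC [1 + y]addrC exprDn exprD1n mulr_sumr reverse_eval_sum.
apply: eq_bigr => i _; rewrite expr1n mulr1 mulrnAr -exprD -!scaler_nat.
have ia : (i <= a)%N by rewrite -ltnS.
rewrite reverse_evalZ reverse_eval_Xn; last by lia.
by congr (_ *: _ ^+ _); lia.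
Qed.

Lemma exprMn2B1 (p : {poly A}) m :
  (p *+ 2 - 1) ^+ m =
  \sum_(i < m.+1) ((-1) ^+ i * 2 ^+ (m - i) *+ 'C(m, i)) *: p ^+ (m - i).
Proof.
rewrite exprDn; apply: eq_bigr => i _.
rewrite -mul_polyC rmorphMn rmorphM !rmorphXn rmorphN1 rmorph_nat.
rewrite -[p *+ 2]mulr_natl exprMn.
ring.
Qed.

End Reversal.

Lemma signr_square (A : comNzRingType) n : (-1) ^+ n * (-1) ^+ n = 1 :> A.
Proof. by rewrite -expr2 sqrr_sign. Qed.

Lemma sign_cancel (A : comNzRingType) (a b c d e : A) : e * e = 1 ->
  a * b * c * d = a * e * c * (e * d * b).
Proof. by move=> ee; rewrite -[LHS]mul1r -ee; ring. Qed.

Lemma sign_cancel_sub (A : comNzRingType) (a b c e : A) : e * e = 1 ->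
  e * c * (e * a + e * b) - c * b = c * a.
Proof. by move=> ee; rewrite -[RHS]mul1r -[in LHS](mul1r (c * b)) -ee; ring. Qed.

Section Main.
Context {R : realType} {k : nat} {W : choiceType}.
Context (L : {fset {fset W}}) (pos : W -> 'rV[R]_k.+1).
Hypothesis hk : (1 <= k)%N.
Hypothesis hL : simplex_triangulation L pos.
Hypothesis hbd : no_new_boundary_vertices L pos.
Hypothesis hint : interior_vertices L pos <> fset0.

Local Notation bd := (boundary_complex L pos).
Local Notation B := (boundary_vertices L pos).
Let cL : is_complex L := triang_complex hL.

(** z at - x, that is - (1 + x) / 2. *)
Definition reflected_z : {poly R} := - (2^-1 *: (1 + 'X)).

(** (-2t)^(k+1) r_L(-(1+t)/(2t), -(1+x)/2) with the denominators cleared; the outer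
    variable is t and the inner one is x. *)
Definition magic_recurrence_poly : {poly {poly R}} :=
  \sum_(s <- interior_faces L B)
    (- 2) ^+ (k.+1 - #|` s `&` B|) * reflected_z ^+ #|` s `\` B|
      *: ('X^(k.+1 - #|` s `&` B|) * (1 + 'X) ^+ #|` s `&` B|)
  - (1 + 'X) ^+ k.+1.

Let card_old_le s : s \in interior_faces L B -> (#|` s `&` B| <= k.+1)%N.
Proof. by move=> /(interior_face_old hk hL hbd hint) /ltnW. Qed.

(** An interior face has at most k original vertices, so that its term is divisible by
    t. *)
Lemma magic_recurrence_poly0 : magic_recurrence_poly`_0 = -1.
Proof.
rewrite -horner_coef0 hornerD hornerN horner_exp hornerD hornerX hornerC addr0 expr1n.
rewrite horner_sum big1_fset ?add0r // => s sI _.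
have a_lt := interior_face_old hk hL hbd hint sI.
by rewrite hornerZ hornerM hornerXn expr0n subn_eq0 leqNgt a_lt mul0r mulr0.
Qed.

(** The variable x of R[x] expressed through u = (x - 1) / 2. *)
Definition x_in_u : {poly {poly R}} := 'X *+ 2 + 1.

Lemma reflected_zE : - 1 - z_poly = reflected_z.
Proof.
have e : 2^-1 *: (1 + 1) = 1 :> {poly R}.
  by rewrite -mulr2n -scaler_nat scalerA mulVf ?scale1r // pnatr_eq0.
by rewrite /reflected_z /z_poly -{1}e -opprD -scalerDr; congr (- (_ *: _)); ring.
Qed.

(** Reversal substitutes t = 1 / (2u + 1) and multiplies by (2u + 1)^(k+1).  The result
    is (-2)^(k+1) r_L(-1-u, -1-z), which reciprocity turns into 2^(k+1) r_L(u, z). *)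
Lemma reverse_magic_recurrence_poly :
  reverse_eval k.+1 x_in_u magic_recurrence_poly =
  2 ^+ k.+1 *: magic_value L B 'X (z_poly (R := R))%:P.
Proof.
have x_in_uE : 1 + x_in_u = 2 *: (1 + 'X) by rewrite /x_in_u scaler_nat; ring.
rewrite /magic_recurrence_poly reverse_evalB reverse_eval_sum.
have -> : (1 + 'X : {poly {poly R}}) ^+ k.+1 = 'X^(k.+1 - k.+1) * (1 + 'X) ^+ k.+1.
  by rewrite subnn mul1r.
rewrite reverse_eval_term // x_in_uE exprZn.
have -> : \sum_(s <- interior_faces L B) reverse_eval k.+1 x_in_u
    ((- 2) ^+ (k.+1 - #|` s `&` B|) * reflected_z ^+ #|` s `\` B|
      *: ('X^(k.+1 - #|` s `&` B|) * (1 + 'X) ^+ #|` s `&` B|)) =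
   (- 2) ^+ k.+1 *: weight_sum (fun w => if w \in B then - 1 - 'X else - 1 - (z_poly (R := R))%:P)
      (interior_faces L B).
  rewrite scaler_sumr; apply: eq_fbigr => s sI _.
  have a_le := card_old_le sI; rewrite reverse_evalZ reverse_eval_term // x_in_uE face_weight_mem.
  have -> : - 1 - (z_poly (R := R))%:P = reflected_z%:P.
    by rewrite -reflected_zE rmorphB rmorphN1.
  have -> : - 1 - 'X = - (1 + 'X) :> {poly {poly R}} by ring.
  rewrite exprZn scalerA [(- (1 + 'X)) ^+ _]exprNn -!mul_polyC -!polyC_exp.
  have -> : (- 2 : {poly R}) ^+ k.+1 =
     (- 2) ^+ (k.+1 - #|` s `&` B|) * (-1) ^+ #|` s `&` B| * 2 ^+ #|` s `&` B|.
    by rewrite -mulrA -exprMn mulN1r -exprD subnK.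
  rewrite !polyCM [((-1) ^+ _)%:P]rmorphXn rmorphN1.
  exact: sign_cancel (signr_square _ _).
have := magic_reciprocity hk hL hbd hint ('X : {poly {poly R}}) (z_poly%:P).
rewrite {1}/magic_value (card_boundary_vertices hL hbd hk).
move=> /eqP; rewrite subr_eq => /eqP ->.
have -> : - 1 - 'X = - (1 + 'X) :> {poly {poly R}} by ring.
rewrite [(- (1 + 'X)) ^+ _]exprNn [(- 2) ^+ _]exprNn -!mul_polyC polyCM.
rewrite [((-1) ^+ _)%:P]rmorphXn rmorphN1.
exact: sign_cancel_sub (signr_square _ _).
Qed.

Lemma magic_polyE : magic_poly L pos =
  \sum_(s <- interior_faces L B) 'X ^+ #|` s `&` B| * 'Y ^+ #|` s `\` B| - 'X ^+ k.+1.
Proof.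
rewrite /magic_poly (interior_facesE hk hL hbd hint); congr (_ - _).
apply: eq_fbigr => s; rewrite !inE /= => /andP[sL _] _; congr (_ * _ ^+ #|` _|).
apply/fsetP => w; rewrite in_fsetI in_fsetD (mem_interior_vertices hL hbd hk).
case ws: (w \in s); rewrite ?andbF //= andbT.
by rewrite (fsubsetP (sub_vertices sL) w ws).
Qed.

Lemma magic_poly_eval (F : comNzRingType) (f : {rmorphism R -> F}) (u v : F) :
  (map_poly (map_poly f) (magic_poly L pos)).[u, v] =
  \sum_(s <- interior_faces L B) u ^+ #|` s `&` B| * v ^+ #|` s `\` B| - u ^+ k.+1.
Proof.
rewrite magic_polyE rmorphB rmorph_sum hornerD hornerN horner_sum hornerD hornerN horner_sum /=.
rewrite rmorphXn /= map_polyX !hornerXn -polyC_exp hornerC; congr (_ - _).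
apply: eq_bigr => s _; rewrite rmorphM !rmorphXn /= map_polyX map_polyC /= map_polyX.
by rewrite hornerM !horner_exp hornerX hornerC -polyC_exp hornerM hornerC horner_exp hornerX.
Qed.

(** Stated for a morphism into any field, which stands for the embedding into the
    rational functions. *)
Lemma magic_recurrence_poly_morph (F : fieldType) (f : {rmorphism {poly {poly R}} -> F}) :
  (2 : F) != 0 -> f 'X != 0 ->
  f magic_recurrence_poly = (- (2 * f 'X)) ^+ k.+1 *
    (\sum_(s <- interior_faces L B)
       (- ((1 + f 'X) / (2 * f 'X))) ^+ #|` s `&` B| *
       (- ((1 + f 'Y) / 2)) ^+ #|` s `\` B| - (- ((1 + f 'X) / (2 * f 'X))) ^+ k.+1).
Proof.
move=> two_neq0 t_neq0; set u := - (_ / (2 * _)); set v := - (_ / 2).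
have tu : - (2 * f 'X) * u = 1 + f 'X.
  by rewrite /u mulrNN mulrC divfK // mulf_neq0.
have vE : f reflected_z%:P = v.
  have half : f (2^-1)%:P%:P = 2^-1.
    apply: (mulfI two_neq0); rewrite mulfV // -(rmorph_nat f) -rmorphM /=.
    by rewrite -polyC_natr -polyC_natr -!polyCM mulfV ?pnatr_eq0 ?rmorph1.
  by rewrite /reflected_z -mul_polyC !(rmorphN, rmorphM, rmorphD, rmorph1) /= half /v mulrC.
rewrite mulrBr -exprMn tu mulr_sumr /magic_recurrence_poly rmorphB rmorph_sum /=.
congr (_ - _); last by rewrite rmorphXn rmorphD rmorph1.
apply: eq_fbigr => s sI _; have := card_old_le sI; set a := #|` s `&` B| => ak.
rewrite -mul_polyC polyCM !rmorphM !rmorphXn /= vE.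
have -> : f (- 2)%:P = - 2 by rewrite polyCN rmorphN polyC_natr rmorph_nat.
rewrite [f (1 + _)]rmorphD rmorph1 -tu -[in RHS](subnK ak) exprD !exprMn -mulNr !exprMn.
by rewrite mulrACA -[RHS]mulrA; congr (_ * _); rewrite [LHS]mulrC -[LHS]mulrA.
Qed.

Lemma magic_recurrence_polyE :
  let t : {fraction {poly {poly R}}} := tofrac 'X in
  let x : {fraction {poly {poly R}}} := tofrac 'Y in
  tofrac magic_recurrence_poly = (- (2 * t)) ^+ k.+1 *
    eval_frac (magic_poly L pos) (- ((1 + t) / (2 * t))) (- ((1 + x) / 2)).
Proof.
move=> t x; have two_neq0 : (2 : {fraction {poly {poly R}}}) != 0.
  rewrite -(rmorph_nat (@tofrac _)) tofrac_eq0 -polyC_natr polyC_eq0.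
  by rewrite -polyC_natr polyC_eq0 pnatr_eq0.
have t_neq0 : t != 0 by rewrite tofrac_eq0 polyX_eq0.
rewrite (magic_recurrence_poly_morph (f := @tofrac {poly {poly R}}) two_neq0 t_neq0).
congr (_ * _); apply/esym.
exact: (magic_poly_eval (@tofrac {poly {poly R}} \o (polyC \o polyC))).
Qed.

(** The sum is [reduced_eval] of a multiple of r_L(u, z). *)
Lemma reduced_eval_recurrence n m : (k.+1 <= m)%N ->
  \sum_(l < k.+2) magic_recurrence_poly`_l * reduced_eval L pos n (x_in_u ^+ (m - l)) = 0.
Proof.
move=> km; apply: etrans (reduced_eval_magic L pos n (2 ^+ k.+1 *: x_in_u ^+ (m - k.+1))).
rewrite -scalerAl mulrC scalerAl -reverse_magic_recurrence_poly /reverse_eval mulr_suml.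
rewrite (reduced_eval_sum hk hL hbd hint); apply: eq_bigr => l _.
rewrite -scalerAl (reduced_evalZ hk hL hbd hint) -exprD; congr (_ * reduced_eval _ _ _ (_ ^+ _)).
have := ltn_ord l; lia.
Qed.

Variables (j : nat) (U : {linear {poly R} -> {poly R}}).
Hypothesis hU : is_tchebyshev_map L pos j U.

(** Expand x = 2 y - 1 with y = (x + 1) / 2 in powers of y, whose images are known; on
    the side of u the same expansion uses 2u + 1 = 2 (u + 1) - 1. *)
Lemma tchebyshev_map_Xn m : U 'X^m = reduced_eval L pos (j - 1) (x_in_u ^+ m).
Proof.
(* The F-polynomials of the full simplices are the powers of y. *)
pose y : {poly R} := 2^-1 *: ('X + 1).
have -> : 'X = y *+ 2 - 1 :> {poly R}.
  by rewrite /y -scaler_nat scalerA mulfV ?pnatr_eq0 // scale1r addrK.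
have -> : x_in_u = ('X + 1) *+ 2 - 1 by rewrite /x_in_u; ring.
rewrite !exprMn2B1 linear_sum (reduced_eval_sum hk hL hbd hint); apply: eq_bigr => i _.
rewrite linearZ (reduced_evalZ hk hL hbd hint) /= -mul_polyC (tchebyshev_map_simplex hk hL hbd hint hU).
by rewrite rmorphMn rmorphM !rmorphXn rmorphN1 rmorph_nat.
Qed.

End Main.

Theorem theorem8p5 (R : realType) (k : nat) (hk : (1 <= k)%N)
  (W : choiceType) (L : {fset {fset W}}) (pos : W -> 'rV[R]_k.+1)
  (hL : simplex_triangulation L pos)
  (hbd : no_new_boundary_vertices L pos)
  (hint : interior_vertices L pos <> fset0)
  (j : nat) (hj : (2 <= j <= k.+1)%N)
  (U : {linear {poly R} -> {poly R}})
  (hU : is_tchebyshev_map L pos j U) :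
  exists P : {poly {poly R}},
    (let t : {fraction {poly {poly R}}} := tofrac 'X in
     let x : {fraction {poly {poly R}}} := tofrac 'Y in
     tofrac P = (- (2 * t)) ^+ k.+1 *
       eval_frac (magic_poly L pos) (- ((1 + t) / (2 * t))) (- ((1 + x) / 2))) /\
    forall n : nat, (k.+1 <= n)%N ->
      tchebyshev_poly U j n =
        \sum_(1 <= l < k.+2) P`_l * tchebyshev_poly U j (n - l).
Proof.
exists (magic_recurrence_poly L pos); split.
  exact: (magic_recurrence_polyE hk hL hbd hint).
move=> n kn; have km : (k.+1 <= n + (j - 1))%N by apply: leq_trans kn (leq_addr _ _).
have := reduced_eval_recurrence hk hL hbd hint (j - 1) km.
rewrite -(big_mkord xpredT (fun l => (magic_recurrence_poly L pos)`_l *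
  reduced_eval L pos (j - 1) (x_in_u ^+ (n + (j - 1) - l)))).
rewrite big_ltn // (magic_recurrence_poly0 hk hL hbd hint) mulN1r subn0.
move=> /eqP; rewrite addrC subr_eq0 => /eqP rec.
rewrite /tchebyshev_poly (tchebyshev_map_Xn hk hL hbd hint hU) -rec scaler_sumr.
apply: eq_big_nat => l /andP[_ lk].
rewrite (tchebyshev_map_Xn hk hL hbd hint hU) -scalerAr.
by congr (_ *: (_ * reduced_eval _ _ _ (_ ^+ _))); lia.
Qed.
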